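(* Let $p$ be a prime, $S$ a finite $p$-group, $\mathcal{F}$ a saturated fusion system on $S$, and $\Omega=\Lambda_{\mathcal{F}}$ the minimal $\mathcal{F}$-characteristic biset. Let $P\le S$ and $K\le\mathrm{Aut}(P)$ be such that $K\ge\mathrm{Inn}(P)$ or $K\le\mathrm{Inn}(P)$. Put $N=N_S^K(P)$ and $\mathcal{N}=N_{\mathcal{F}}^K(P)$. If $P$ is fully $K$-normalized in $\mathcal{F}$, then $N_\Omega^K(P)$ is an $\mathcal{N}$-characteristic $(N,N)$-biset that contains precisely one copy of $\Lambda_{\mathcal{N}}$, the minimal characteristic biset for $\mathcal{N}$. Moreover, if $P$ is in addition $\mathcal{F}$-centric, then $N_\Omega^K(P)\cong\Lambda_{\mathcal{N}}$ as $(N,N)$-bisets.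
   Context: Fusion systems and saturation are in the usual sense (Puig; Broto-Levi-Oliver). $\mathcal{F}(P,Q)$ denotes the set of $\mathcal{F}$-morphisms $P\to Q$ for $P,Q\le S$. $P$ is $\mathcal{F}$-centric if $C_S(Q)\le Q$ for every $Q$ that is $\mathcal{F}$-isomorphic to $P$. For $P\le S$ and $K\le\mathrm{Aut}(P)$: $N_S^K(P)=\{n\in N_S(P)\mid c_n|_P\in K\}$; for an isomorphism $\varphi\colon P\to Q$, ${}^{\varphi}K=\varphi K\varphi^{-1}\le\mathrm{Aut}(Q)$; $P$ is fully $K$-normalized in $\mathcal{F}$ if $|N_S^K(P)|\ge|N_S^{{}^{\varphi}K}(\varphi(P))|$ for all $\varphi\in\mathcal{F}(P,S)$. $N_{\mathcal{F}}^K(P)$ is the fusion system on $N_S^K(P)$ whose morphisms $A\to B$ are the $\varphi\in\mathcal{F}(A,B)$ that extend to some $\widetilde\varphi\in\mathcal{F}(PA,PB)$ with $\widetilde\varphi(P)=P$ and $\widetilde\varphi|_P\in K$. It is known (Puig) that $N_{\mathcal{F}}^K(P)$ is saturated if $P$ is fully $K$-normalized in $\mathcal{F}$. All bisets are finite. For a finite $p$-group $T$, a $(T,T)$-biset is a finite set $\Omega$ with a free left $T$-action and a free right $T$-action that commute; equivalently a left $(T\times T)$-set via $(b,a)\cdot\omega=b\cdot\omega\cdot a^{-1}$ on which $T\times 1$ and $1\times T$ act freely. For $Q\le T$ and an injective homomorphism $\psi\colon Q\to T$, write $(Q,\psi)=\{(\psi(a),a)\mid a\in Q\}\le T\times T$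 and $[Q,\psi]\cong(T\times T)/(Q,\psi)$. Every point-stabilizer in a $(T,T)$-biset has the form $(Q,\psi)$. $\Omega^{(Q,\psi)}$ denotes the set of points fixed by $(Q,\psi)$. Let $\mathcal{G}$ be a fusion system on $T$. $\Omega$ is $\mathcal{G}$-generated if every point-stabilizer is of the form $(Q,\psi)$ with $\psi\in\mathcal{G}(Q,T)$. $\Omega$ is $\mathcal{G}$-stable if for every $Q\le T$, injective homomorphism $\psi\colon Q\to T$, and $\mathcal{G}$-isomorphisms $\eta_1\colon Q'\to Q$ and $\eta_2\colon\psi(Q)\to R$, one has $|\Omega^{(Q,\psi)}|=|\Omega^{(Q',\eta_2\psi\eta_1)}|$. $\Omega$ is $\mathcal{G}$-semicharacteristic if it is $\mathcal{G}$-generated and $\mathcal{G}$-stable, and $\mathcal{G}$-characteristic if moreover $|\Omega|/|T|\not\equiv 0\pmod p$. Every saturated $\mathcal{G}$ has a unique (up to isomorphism) minimal $\mathcal{G}$-characteristic biset $\Lambda_{\mathcal{G}}$, meaning one that is, up to isomorphism, contained in every $\mathcal{G}$-characteristic biset. The monoid of isomorphism classes of $\mathcal{G}$-semicharacteristic bisets under disjoint union is free, with $\Lambda_{\mathcal{G}}$ one of its basis elements; a $\mathcal{G}$-semicharacteristic biset contains precisely one copy of $\Lambda_{\mathcal{G}}$ if the coefficient of $\Lambda_{\mathcal{G}}$ in its decomposition is $1$ (equivalently, it has exactly one orbit isomorphic to $[T,\mathrm{id}_T]$). For an $(S,S)$-biset $\Omega$, $N_\Omega^K(P)$ is the set of $\omega\in\Omega$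 whose stabilizer $\mathrm{Stab}_{S\times S}(\omega)=(Q,\psi)$ satisfies $P\le Q$, $\psi(P)=P$ and $\psi|_P\in K$; by restricting the actions it is an $(N_S^K(P),N_S^K(P))$-biset. *)

(* Defs.v *)
From HB Require Import structures.
From mathcomp Require Import all_boot all_fingroup all_solvable.

Set Implicit Arguments.
Unset Strict Implicit.
Unset Printing Implicit Defensive.

Local Open Scope group_scope.

(* A homomorphism defined on P is represented by a total function gT -> gT of
   which only the values on P matter (see fmor_ext). *)
Definition injhom (gT : finGroupType) (P Q : {group gT}) (f : gT -> gT) : Prop :=
  [/\ morphic P f, {in P &, injective f} & f @: P \subset Q].

(* fmor P Q f reads f \in F(P, Q). The composition and inclusion axioms, with
   fmor_fact, say that every morphism is an isomorphism of the category
   followed by an inclusion. *)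
Record fusion_system (gT : finGroupType) (S : {group gT}) := FusionSystem {
  fmor :> {group gT} -> {group gT} -> pred (gT -> gT);
  fmor_sub : forall P Q f, fmor P Q f -> P \subset S /\ Q \subset S;
  fmor_injhom : forall P Q f, fmor P Q f -> injhom P Q f;
  fmor_ext : forall (P Q : {group gT}) f g,
    {in P, f =1 g} -> fmor P Q f -> fmor P Q g;
  fmor_conj : forall (P Q : {group gT}) s,
    P \subset S -> Q \subset S -> s \in S -> P :^ s \subset Q ->
    fmor P Q (conjg^~ s);
  fmor_comp : forall P Q R f g,
    fmor P Q f -> fmor Q R g -> fmor P R (g \o f);
  fmor_fact : forall (P Q R : {group gT}) f,
    fmor P Q f -> f @: P = R ->
    fmor P R f /\ exists2 g, fmor R P g & {in P, cancel f g}
}.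

Definition fiso (gT : finGroupType) (S : {group gT}) (F : fusion_system S)
    (P Q : {group gT}) (f : gT -> gT) : bool :=
  F P Q f && (f @: P == Q).

(* Aut_F(P) and Aut_S(P), as sets of permutations of gT fixing every point
   outside P. *)
Definition Aut_fusion (gT : finGroupType) (S : {group gT})
    (F : fusion_system S) (P : {group gT}) : {set {perm gT}} :=
  [set a in Aut P | F P P a].

Definition Aut_by (gT : finGroupType) (S P : {group gT}) : {set {perm gT}} :=
  conj_aut P @* 'N_S(P).

Definition Inn (gT : finGroupType) (P : {group gT}) : {set {perm gT}} :=
  conj_aut P @* P.

Definition fully_normalized (gT : finGroupType) (S : {group gT})
    (F : fusion_system S) (P : {group gT}) : Prop :=
  forall Q f, fiso F P Q f -> #|'N_S(Q)| <= #|'N_S(P)|.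

Definition fully_centralized (gT : finGroupType) (S : {group gT})
    (F : fusion_system S) (P : {group gT}) : Prop :=
  forall Q f, fiso F P Q f -> #|'C_S(Q)| <= #|'C_S(P)|.

(* N_f = {g in N_S(P) | f c_g f^-1 in Aut_S(Q)}, for an isomorphism f from P
   to Q. *)
Definition extender (gT : finGroupType) (S P Q : {group gT})
    (f : gT -> gT) : {set gT} :=
  [set g in 'N_S(P) | [exists h in 'N_S(Q),
     [forall x in P, f (x ^ g) == f x ^ h]]].

(* The definition of Broto, Levi and Oliver. *)
Definition saturated (p : nat) (gT : finGroupType) (S : {group gT})
    (F : fusion_system S) : Prop :=
  (forall P : {group gT}, P \subset S -> fully_normalized F P ->
     fully_centralized F P /\ p.-Sylow(Aut_fusion F P) (Aut_by S P)) /\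
  (forall (P Q : {group gT}) f, F P S f -> f @: P = Q ->
     fully_centralized F Q ->
     exists (D : {group gT}) (g : gT -> gT),
       [/\ D :=: extender S P Q f, F D S g & {in P, f =1 g}]).

Definition centric (gT : finGroupType) (S : {group gT})
    (F : fusion_system S) (P : {group gT}) : Prop :=
  forall Q f, fiso F P Q f -> 'C_S(Q) \subset Q.

(* N_S^K(P). The library's conj_aut P n is x |-> n^-1 x n, that is c_(n^-1);
   this gives the same set since the sets K used below are closed under
   inverses. *)
Definition autnorm (gT : finGroupType) (S P : {group gT})
    (K : {set {perm gT}}) : {set gT} :=
  S :&: conj_aut P @*^-1 K.

Canonical autnorm_group (gT : finGroupType) (S P : {group gT})
    (K : {group {perm gT}}) : {group gT} :=
  [group of autnorm S P K].

(* f K f^-1, for an isomorphism f from P to Q and K a set of automorphisms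
   of P. *)
Definition autconj (gT : finGroupType) (P Q : {group gT}) (f : gT -> gT)
    (K : {set {perm gT}}) : {set {perm gT}} :=
  [set a in Aut Q | [exists k in K, [forall x in P, a (f x) == f (k x)]]].

Definition fully_autnormalized (gT : finGroupType) (S : {group gT})
    (F : fusion_system S) (P : {group gT}) (K : {set {perm gT}}) : Prop :=
  forall (Q : {group gT}) f, F P S f -> f @: P = Q ->
    #|autnorm S Q (autconj P Q f K)| <= #|autnorm S P K|.

(* f(P) = P and the restriction of f to P is in K *)
Definition restr_in (gT : finGroupType) (P : {group gT})
    (K : {set {perm gT}}) (f : gT -> gT) : bool :=
  (f @: P == P) && [exists k in K, [forall x in P, f x == k x]].

(* For A inside N_S^K(P), the product PA is the join P <*> A. *)
Definition autnorm_mor (gT : finGroupType) (S : {group gT})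
    (F : fusion_system S) (P : {group gT}) (K : {group {perm gT}})
    (A B : {group gT}) (f : gT -> gT) : bool :=
  [&& A \subset autnorm S P K, B \subset autnorm S P K, F A B f &
    [exists g : {ffun gT -> gT},
      [&& F (P <*> A)%G (P <*> B)%G g, restr_in P K g &
          [forall x in A, g x == f x]]]].

Section NormalizerFusionSystem.

Variables (gT : finGroupType) (S : {group gT}) (F : fusion_system S).
Variables (P : {group gT}) (K : {group {perm gT}}).
Hypothesis sPS : P \subset S.

Local Notation N := (autnorm S P K).
Local Notation nmor := (autnorm_mor F P K).

Lemma restr_inP (f : gT -> gT) :
  reflect (f @: P = P /\ exists2 k, k \in K & {in P, f =1 k})
          (restr_in P K f).
Proof.
apply: (iffP andP) => [[/eqP fP /exists_inP[k Kk /forall_inP fk]] | ].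
  by split=> //; exists k => // x /fk/eqP.
case=> fP [k Kk fk]; split; first exact/eqP.
by apply/exists_inP; exists k => //; apply/forall_inP=> x /fk/eqP.
Qed.

Lemma autnorm_morP (A B : {group gT}) (f : gT -> gT) :
  reflect [/\ A \subset N, B \subset N, F A B f &
             exists g : gT -> gT, [/\ F (P <*> A)%G (P <*> B)%G g,
               g @: P = P, (exists2 k, k \in K & {in P, g =1 k}) &
               {in A, g =1 f}]]
          (nmor A B f).
Proof.
apply: (iffP and4P) => [] [sAN sBN Ff].
  case/existsP=> g /and3P[Fg /restr_inP[gP gK] /forall_inP gf].
  by split=> //; exists g; split=> // x /gf/eqP.
case=> g [Fg gP [k Kk gk] gf]; split=> //; apply/existsP; exists (finfun g).
have Eg: finfun g =1 g by move=> x; rewrite ffunE.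
apply/and3P; split.
- by apply: fmor_ext Fg => x _; rewrite Eg.
- apply/restr_inP; split; first by rewrite (eq_imset _ Eg).
  by exists k => // x Px; rewrite Eg gk.
- by apply/forall_inP=> x Ax; rewrite Eg gf.
Qed.

Lemma autnormP n :
  reflect [/\ n \in S, n \in 'N(P) & conj_aut P n \in K] (n \in N).
Proof.
rewrite !inE; apply: (iffP and3P) => -[]; split=> //.
Qed.

Lemma autnorm_join_sub (A : {group gT}) : A \subset N -> P <*> A \subset S.
Proof. by move=> /subsetIP[sAS _]; rewrite join_subG sPS. Qed.

Lemma autnorm_mor_sub A B f : nmor A B f -> A \subset N /\ B \subset N.
Proof. by case/autnorm_morP. Qed.

Lemma autnorm_mor_injhom A B f : nmor A B f -> injhom A B f.
Proof. by case/autnorm_morP=> _ _ /fmor_injhom. Qed.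

Lemma autnorm_mor_ext (A B : {group gT}) f g :
  {in A, f =1 g} -> nmor A B f -> nmor A B g.
Proof.
move=> fg /autnorm_morP[sAN sBN Ff [h [Fh hP hK hf]]].
apply/autnorm_morP; split=> //; first exact: fmor_ext Ff.
by exists h; split=> // x Ax; rewrite hf ?fg.
Qed.

Lemma autnorm_mor_conj (A B : {group gT}) s :
  A \subset N -> B \subset N -> s \in N -> A :^ s \subset B ->
  nmor A B (conjg^~ s).
Proof.
move=> sAN sBN Ns sAsB; have [Ss nPs Ks] := autnormP s Ns.
have [/subsetIP[sAS _] /subsetIP[sBS _]] := (sAN, sBN).
apply/autnorm_morP; split=> //; first exact: fmor_conj.
exists (conjg^~ s); split=> //.
- apply: fmor_conj; rewrite ?autnorm_join_sub //.
  by rewrite conjYg (normP nPs) genS ?setUS.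
- exact: (normP nPs).
- by exists (conj_aut P s) => // x Px; rewrite norm_conj_autE.
Qed.

Lemma autnorm_mor_comp A B C f g :
  nmor A B f -> nmor B C g -> nmor A C (g \o f).
Proof.
case/autnorm_morP=> sAN sBN Ff [f1 [Ff1 f1P [k Kk f1k] f1f]].
case/autnorm_morP=> _ sCN Fg [g1 [Fg1 g1P [l Kl g1l] g1g]].
have [_ _ /subsetP sfAB] := fmor_injhom Ff.
apply/autnorm_morP; split=> //; first exact: fmor_comp Fg.
exists (g1 \o f1); split=> //; first exact: fmor_comp Fg1.
- by rewrite imset_comp f1P.
- exists (k * l) => [|x Px]; first exact: groupM.
  by rewrite permM /= -f1k // g1l // -f1P imset_f.
- by move=> x Ax /=; rewrite f1f // g1g // sfAB // imset_f.
Qed.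

Lemma fmor_sub_restr (A B C D : {group gT}) f :
  F A B f -> C \subset A -> f @: C = D -> F C D f.
Proof.
move=> Ff sCA fC; have [sAS _] := fmor_sub Ff.
have Fi: F C A (conjg^~ 1).
  by apply: fmor_conj; rewrite ?conjsg1 ?(subset_trans sCA).
have /fmor_fact := fmor_comp Fi Ff.
case/(_ D) => [|FD _].
  by rewrite -fC; apply: eq_imset => x /=; rewrite conjg1.
by apply: fmor_ext FD => x _ /=; rewrite conjg1.
Qed.

Lemma autnorm_mor_fact (A B R : {group gT}) f :
  nmor A B f -> f @: A = R ->
  nmor A R f /\ exists2 g, nmor R A g & {in A, cancel f g}.
Proof.
case/autnorm_morP=> sAN sBN Ff [h [Fh hP [k Kk hk] hf]] fA.
have [[_ _ sfB] [mh injh _]] := (fmor_injhom Ff, fmor_injhom Fh).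
have sRN: R \subset N by rewrite -fA (subset_trans sfB).
have hA: h @: A = R by rewrite -fA; apply: eq_in_imset.
have [sPPA sAPA] := joing_sub (erefl (P <*> A)).
have hPA: h @: (P <*> A) = P <*> R.
  have <-: morphm mh @* (P <*> A) = h @: (P <*> A).
    by rewrite morphimEdom.
  rewrite morphimY // !morphimEsub //=.
  by rewrite -[LHS]/((h @: P) <*> (h @: A)) hP hA.
have FhR: F (P <*> A)%G (P <*> R)%G h.
  by apply: fmor_sub_restr Fh _ hPA.
have [_ [g Fg hgK]] := fmor_fact FhR hPA.
have FR: F A R f.
  by case: (fmor_fact Ff fA).
have gR: g @: R = A.
  rewrite -hA -imset_comp -[RHS]imset_id; apply: eq_in_imset => x Ax /=.
  by rewrite hgK // (subsetP sAPA).
split.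
  by apply/autnorm_morP; split=> //; exists h; split=> //; exists k.
exists g => [|x Ax]; last by rewrite -hf // hgK // (subsetP sAPA).
apply/autnorm_morP; split=> //.
  by apply: fmor_sub_restr Fg _ gR; apply: (joing_subr P R).
exists g; split=> //.
- rewrite -[in LHS]hP -imset_comp -[RHS]imset_id; apply: eq_in_imset => x Px /=.
  by rewrite hgK // (subsetP sPPA).
- exists k^-1 => [|y]; first by rewrite groupV.
  rewrite -{1}hP => /imsetP[x Px ->].
  by rewrite hgK ?(subsetP sPPA) // hk // permK.
Qed.

(* N_F^K(P) *)
Definition autnorm_fusion : fusion_system (autnorm_group S P K) :=
  FusionSystem autnorm_mor_sub autnorm_mor_injhom autnorm_mor_ext
    autnorm_mor_conj autnorm_mor_comp autnorm_mor_fact.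

End NormalizerFusionSystem.

(* A (T,T)-biset, presented as a right action of T x T, with
   x.(b, a) = b^-1 x a. Then (b, a) fixes x if and only if b x a^-1 = x, so
   that stabilizers and fixed points are those of the corresponding left
   action (b, a).x = b x a^-1. *)
Record biset (gT : finGroupType) (T : {group gT}) := Biset {
  bcar :> finType;
  bact : action (setX T T) bcar;
  bact_freel : forall (x : bcar) b, b \in T -> bact x (b, 1) = x -> b = 1;
  bact_freer : forall (x : bcar) a, a \in T -> bact x (1, a) = x -> a = 1
}.

Definition biset_hom (gT : finGroupType) (T : {group gT}) (X Y : biset T)
    (f : X -> Y) : Prop :=
  forall x u, u \in setX T T -> f (bact X x u) = bact Y (f x) u.

Definition biset_iso (gT : finGroupType) (T : {group gT})
    (X Y : biset T) : Prop :=
  exists2 f : X -> Y, bijective f & biset_hom f.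

Definition biset_embeds (gT : finGroupType) (T : {group gT})
    (X Y : biset T) : Prop :=
  exists2 f : X -> Y, injective f & biset_hom f.

(* The subgroup (Q, f) of T x T. *)
Definition graph (gT : finGroupType) (Q : {set gT}) (f : gT -> gT) :
    {set gT * gT} :=
  [set (f a, a) | a in Q].

Definition bstab (gT : finGroupType) (T : {group gT}) (X : biset T) (x : X) :
    {set gT * gT} :=
  'C_(setX T T)[x | bact X].

Definition generated_biset (gT : finGroupType) (T : {group gT})
    (G : fusion_system T) (X : biset T) : Prop :=
  forall x : X, exists (Q : {group gT}) (f : gT -> gT),
    G Q T f /\ bstab x = graph Q f.

Definition stable_biset (gT : finGroupType) (T : {group gT})
    (G : fusion_system T) (X : biset T) : Prop :=
  forall (Q Q' D R : {group gT}) (f h1 h2 : gT -> gT),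
    Q \subset T -> injhom Q T f -> f @: Q = D ->
    fiso G Q' Q h1 -> fiso G D R h2 ->
    #|'Fix_(bact X)(graph Q f)| = #|'Fix_(bact X)(graph Q' (h2 \o f \o h1))|.

Definition semichar_biset (gT : finGroupType) (T : {group gT})
    (G : fusion_system T) (X : biset T) : Prop :=
  generated_biset G X /\ stable_biset G X.

Definition char_biset (p : nat) (gT : finGroupType) (T : {group gT})
    (G : fusion_system T) (X : biset T) : Prop :=
  semichar_biset G X /\ #|X| %/ #|T| != 0 %[mod p].

(* X is the minimal characteristic biset of G (up to isomorphism). *)
Definition minimal_char_biset (p : nat) (gT : finGroupType)
    (T : {group gT}) (G : fusion_system T) (X : biset T) : Prop :=
  char_biset p G X /\
  forall Y : biset T, char_biset p G Y -> biset_embeds X Y.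

Section DisjointUnion.

Variables (gT : finGroupType) (T : {group gT}) (I : finType).
Variable B : I -> biset T.

Definition bunion_act (x : {i : I & B i}) (u : gT * gT) : {i : I & B i} :=
  Tagged (fun i => B i) (bact (B (tag x)) (tagged x) u).

Lemma bunion_is_action : is_action (setX T T) bunion_act.
Proof.
split=> [u [i x] [j y] | [i x] u v Tu Tv].
  rewrite /bunion_act /= => /eqP; rewrite -tag_eqE /tag_eq /=.
  case/andP=> /eqP eij; move: y; rewrite -{}eij => y.
  by rewrite tagged_asE => /eqP/act_inj->.
by rewrite /bunion_act /= actMin.
Qed.

Definition bunion_action := Action bunion_is_action.

Lemma bunion_actK x u : bunion_action x u = x ->
  bact (B (tag x)) (tagged x) u = tagged x.
Proof.
case: x => i x /= /eqP; rewrite -tag_eqE /tag_eq /= eqxx /=.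
by rewrite tagged_asE => /eqP.
Qed.

Lemma bunion_freel (x : {i : I & B i}) b :
  b \in T -> bunion_action x (b, 1) = x -> b = 1.
Proof. by move=> Tb /bunion_actK; apply: bact_freel. Qed.

Lemma bunion_freer (x : {i : I & B i}) a :
  a \in T -> bunion_action x (1, a) = x -> a = 1.
Proof. by move=> Ta /bunion_actK; apply: bact_freer. Qed.

Definition bunion : biset T := Biset bunion_freel bunion_freer.

End DisjointUnion.

(* The basis elements of the free monoid of isomorphism classes of
   semicharacteristic bisets: its indecomposable elements. *)
Definition indecomposable (gT : finGroupType) (T : {group gT})
    (G : fusion_system T) (X : biset T) : Prop :=
  [/\ semichar_biset G X, 0 < #|X| &
    forall B : bool -> biset T, (forall i, semichar_biset G (B i)) ->
      biset_iso X (bunion B) -> #|B true| = 0 \/ #|B false| = 0].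

(* In the decomposition of X into basis elements, L occurs with
   coefficient 1. *)
Definition contains_precisely_one (gT : finGroupType) (T : {group gT})
    (G : fusion_system T) (L X : biset T) : Prop :=
  exists (I : finType) (B : I -> biset T),
    [/\ forall i, indecomposable G (B i), biset_iso X (bunion B) &
        exists! i, biset_iso (B i) L].

Section SubBiset.

Variables (gT : finGroupType) (T N : {group gT}) (X : biset T) (A : {set X}).
Hypothesis nA : setX N N \subset 'N(A | bact X).

Lemma sub_biset_dom :
  setX N N \subset subact_dom (mem A) (bact X).
Proof.
suff ->: subact_dom (mem A) (bact X) = 'N(A | bact X) by [].
by congr ('N(_ | _)); apply/setP=> x; rewrite inE.
Qed.

Definition sub_biset_action :
    action (setX N N) {x : X | x \in A} :=
  ((bact X)^? \ sub_biset_dom)%act.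

Lemma sub_biset_actE x u : u \in setX N N ->
  val (sub_biset_action x u) = bact X (val x) u.
Proof.
by move=> Nu; rewrite ractE val_subact (subsetP sub_biset_dom).
Qed.

Lemma sub_biset_dom_mem u : u \in setX N N -> u \in setX T T.
Proof. by move/(subsetP nA)/(subsetP (subsetIl _ _)). Qed.

Lemma sub_biset_freel (x : {x : X | x \in A}) b :
  b \in N -> sub_biset_action x (b, 1) = x -> b = 1.
Proof.
move=> Nb; have Nb1: (b, 1) \in setX N N by rewrite inE Nb group1.
move/(congr1 val); rewrite sub_biset_actE //; apply: bact_freel.
by case/setXP: (sub_biset_dom_mem Nb1).
Qed.

Lemma sub_biset_freer (x : {x : X | x \in A}) a :
  a \in N -> sub_biset_action x (1, a) = x -> a = 1.
Proof.
move=> Na; have Na1: (1, a) \in setX N N by rewrite inE Na group1.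
move/(congr1 val); rewrite sub_biset_actE //; apply: bact_freer.
by case/setXP: (sub_biset_dom_mem Na1).
Qed.

(* The subset A of X, as an (N,N)-biset by restriction of the actions. *)
Definition sub_biset : biset N := Biset sub_biset_freel sub_biset_freer.

End SubBiset.

(* The underlying set of N_X^K(P). *)
Definition autnorm_pts (gT : finGroupType) (S : {group gT}) (X : biset S)
    (P : {group gT}) (K : {set {perm gT}}) : {set X} :=
  [set x : X | [exists Q : {group gT}, [exists f : {ffun gT -> gT},
     [&& bstab x == graph Q f, P \subset Q & restr_in P K f]]]].

Section NormalizerBiset.

Variables (gT : finGroupType) (S : {group gT}) (X : biset S).
Variables (P : {group gT}) (K : {group {perm gT}}).

Lemma autnorm_ptsP (x : X) :
  reflect (exists (Q : {group gT}) (f : gT -> gT),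
             [/\ bstab x = graph Q f, P \subset Q & restr_in P K f])
          (x \in autnorm_pts X P K).
Proof.
rewrite inE; apply: (iffP existsP) => [[Q /existsP[f]] | [Q [f [Ef sPQ fP]]]].
  by case/and3P=> /eqP Ef sPQ fP; exists Q, f.
exists Q; apply/existsP; exists (finfun f).
have Eg: finfun f =1 f by move=> y; rewrite ffunE.
rewrite sPQ /= /graph (eq_imset _ (_ : _ =1 fun a => (f a, a))) => [|y].
  rewrite Ef eqxx /=; case/restr_inP: fP => fP [k Kk fk]; apply/restr_inP.
  split; first by rewrite (eq_imset _ Eg).
  by exists k => // y Py; rewrite Eg fk.
by rewrite Eg.
Qed.

Lemma bstabP (x : X) u :
  reflect (u \in setX S S /\ bact X x u = x) (u \in bstab x).
Proof.
apply: (iffP setIP) => -[Su].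
  by case/setIP=> _; rewrite inE => /subsetP/(_ x (set11 x)); rewrite inE => /eqP.
move=> xu; split=> //; apply/setIP; split=> //.
by rewrite inE; apply/subsetP=> y /set1P->; rewrite inE xu.
Qed.

Lemma bstab_act (x : X) w :
  w \in setX S S -> bstab (bact X x w) = bstab x :^ w.
Proof.
move=> Sw; apply/setP=> u; rewrite mem_conjg; apply/bstabP/bstabP.
  case=> Su xwu; split; first by rewrite groupJ ?groupV.
  by rewrite conjgE invgK !actMin ?groupM ?groupV // xwu actKin.
case; rewrite groupJr ?groupV // => Su; rewrite conjgE invgK => xu; split=> //.
by rewrite -{2}xu !actMin ?groupM ?groupV // actKVin.
Qed.

Lemma autnorm_pts_act x u : u \in setX (autnorm S P K) (autnorm S P K) ->
  x \in autnorm_pts X P K -> bact X x u \in autnorm_pts X P K.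
Proof.
case: u => m n; rewrite inE /= => /andP[Nm Nn].
have [Sm nPm Km] := autnormP _ _ _ _ Nm; have [Sn nPn Kn] := autnormP _ _ _ _ Nn.
have Smn: (m, n) \in setX S S by rewrite inE Sm.
case/autnorm_ptsP=> Q [f [Ef sPQ /restr_inP[fP [k Kk fk]]]].
apply/autnorm_ptsP; exists (Q :^ n)%G, (fun a => f (a ^ n^-1) ^ m).
split; last 2 first.
- by rewrite -(normP nPn) conjSg.
- have fE: {in P, (fun a => f (a ^ n^-1) ^ m)
                   =1 ((conj_aut P n)^-1 * k * conj_aut P m)%g}.
    move=> a Pa; have Pa': a ^ n^-1 \in P by rewrite memJ_norm ?groupV.
    have Pf: f (a ^ n^-1) \in P by move: (imset_f f Pa'); rewrite fP.
    have En: (conj_aut P n)^-1%g a = a ^ n^-1.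
      by rewrite -morphV //= norm_conj_autE ?groupV.
    by rewrite !permM En -fk // norm_conj_autE.
  apply/restr_inP; split; last first.
    by exists ((conj_aut P n)^-1 * k * conj_aut P m)%g; rewrite ?groupM ?groupV.
  rewrite -{2}(normP nPm) -{2}fP -{2}(normP (groupVr nPn)).
  by rewrite /conjugate -!imset_comp.
rewrite bstab_act // Ef; apply/setP=> -[c d].
apply/imsetP/imsetP=> [[_ /imsetP[a Qa ->] [-> ->]] | [_ /imsetP[a Qa ->] [-> ->]]].
  by exists (a ^ n); rewrite ?memJ_conjg // ?conjgK // memJ_conjg.
by exists (f a, a); [apply: imset_f | rewrite conjgK].
Qed.

Lemma autnorm_pts_acts :
  setX (autnorm_group S P K) (autnorm_group S P K)
    \subset 'N(autnorm_pts X P K | bact X).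
Proof.
apply/subsetP=> u Nu; apply/setIP; split.
  by move: Nu; rewrite !inE => /andP[/andP[-> _] /andP[-> _]].
by rewrite inE; apply/subsetP=> x Ax; rewrite inE; apply: autnorm_pts_act.
Qed.

(* N_X^K(P) *)
Definition autnorm_biset : biset (autnorm_group S P K) :=
  sub_biset autnorm_pts_acts.

End NormalizerBiset.

(* Main.v *)
Require Import Defs.
From mathcomp Require Import all_boot all_fingroup all_solvable.
From Stdlib Require Import Classical.

Set Implicit Arguments.
Unset Strict Implicit.
Unset Printing Implicit Defensive.

Local Open Scope group_scope.

(* Minimality of Omega enters only through its numbers of fixed points: for Q
   centric in F, Omega^Q, the set of fixed points of the diagonal of Q, is a
   single left orbit of Z(Q). To see this one builds an F-characteristic
   biset with this property, adding orbits S x S / (Q, f) by decreasing order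
   of Q: for Q centric one copy for each f, up to conjugacy, that does not
   extend to a larger subgroup of N_S(Q), and for other Q as many copies as
   stability requires, which is possible by Burnside's orbit counting.

   For X = N_Omega^K(P) and a morphism f of N_F^K(P) defined on R, X^(R,f) is
   the disjoint union of the Omega^(PR,g) over the extensions g of f to PR
   with g(P) = P and g|P in K; hence X is semicharacteristic. As P is fully
   K-normalized, PN is F-centric and Inn(N) is a Sylow subgroup of the
   automorphism group of N, and the g extending the identity of N are the
   conjugations by elements of Z(N). So X^N is a single orbit of Z(N), which
   makes X characteristic with exactly one summand Lambda. If P is centric,
   the same argument applies to X^R for the domain R of any point-stabilizer,
   so a point outside Lambda would give two orbits in some X^R. *)

(** * Fusion systems *)

(** Omega is accessible only through its embeddings into characteristic bisets, so an upper bound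
    for its fixed points requires exhibiting one characteristic biset that has few of them. The
    number |Z(Q)| is the least possible, since Z(Q) acts freely from the left on the points fixed by
    the diagonal of Q. It is attainable because (Q, f) fixes |N(Q, f) : (Q, f)| points of the orbit
    S x S / (Q, f), and this index is |C_S(f(Q))| when f extends to no larger subgroup of N_S(Q);
    for Q centric it equals |Z(Q)|. The alternative for K is what turns an automorphism u of PN that
    is trivial on N and restricts to K on P into a conjugation: if Inn(P) <= K, then P <= N and u is
    the identity; if K <= Inn(P), then u acts on P as an element of P, which turns out to centralize
    N. *)

Section FusionBasics.

Variables (gT : finGroupType) (S : {group gT}) (F : fusion_system S).
Implicit Types P Q R A B : {group gT}.

Lemma fmor_subl P Q f : F P Q f -> P \subset S.
Proof. by case/fmor_sub. Qed.

Lemma fmor_subr P Q f : F P Q f -> Q \subset S.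
Proof. by case/fmor_sub. Qed.

Lemma fmor_in P Q f x : F P Q f -> x \in P -> f x \in Q.
Proof. by case/fmor_injhom=> _ _ /subsetP sfQ Px; rewrite sfQ ?imset_f. Qed.

Lemma fmor_inj P Q f : F P Q f -> {in P &, injective f}.
Proof. by case/fmor_injhom. Qed.

Lemma fmorM P Q f : F P Q f -> {in P &, {morph f : x y / x * y}}.
Proof. by case/fmor_injhom=> /morphicP. Qed.

Lemma fmor1 P Q f : F P Q f -> f 1 = 1.
Proof.
by move=> Ff; apply: (mulgI (f 1)); rewrite -(fmorM Ff) ?group1 ?mulg1.
Qed.

Lemma fmorV P Q f x : F P Q f -> x \in P -> f x^-1 = (f x)^-1.
Proof.
move=> Ff Px; apply: (mulgI (f x)).
by rewrite -(fmorM Ff) ?groupV // !mulgV (fmor1 Ff).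
Qed.

Lemma fmorJ P Q f x y :
  F P Q f -> x \in P -> y \in P -> f (x ^ y) = f x ^ f y.
Proof.
by move=> Ff Px Py; rewrite !conjgE !(fmorM Ff) ?(fmorV Ff) ?groupM ?groupV.
Qed.

Lemma fmor_img P Q A f :
  F P Q f -> A \subset P -> exists R : {group gT}, f @: A = R.
Proof.
move=> Ff sAP; have [mf _ _] := fmor_injhom Ff.
by exists (morphm mf @* A)%G; rewrite /= morphimEsub.
Qed.

Lemma fmor_id P Q : P \subset Q -> Q \subset S -> F P Q id.
Proof.
move=> sPQ sQS; have FPQ: F P Q (conjg^~ 1).
  by apply: fmor_conj; rewrite ?conjsg1 ?(subset_trans sPQ).
by apply: fmor_ext FPQ => x _; rewrite conjg1.
Qed.

Lemma fmor_res P Q A B f :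
  F P Q f -> A \subset P -> B \subset S -> f @: A \subset B -> F A B f.
Proof.
move=> Ff sAP sBS; have [R fA] := fmor_img Ff sAP.
rewrite fA => sRB; apply: (fmor_comp (fmor_sub_restr Ff sAP fA) (fmor_id sRB sBS)).
Qed.

Lemma fmor_resS P Q A f : F P Q f -> A \subset P -> F A S f.
Proof.
move=> Ff sAP; apply: (fmor_res Ff sAP (subxx S)).
apply/subsetP=> _ /imsetP[x Ax ->].
by rewrite (subsetP (fmor_subr Ff)) ?(fmor_in Ff) ?(subsetP sAP).
Qed.

Lemma fiso_mor P Q f : fiso F P Q f -> F P Q f.
Proof. by case/andP. Qed.

Lemma fiso_img P Q f : fiso F P Q f -> f @: P = Q.
Proof. by case/andP=> _ /eqP. Qed.

Lemma fiso_intro P Q R f : F P R f -> f @: P = Q -> fiso F P Q f.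
Proof. by move=> Ff fP; rewrite /fiso (fmor_fact Ff fP).1 fP eqxx. Qed.

Lemma fiso_id P : P \subset S -> fiso F P P id.
Proof. by move=> sPS; rewrite /fiso fmor_id //= imset_id. Qed.

Lemma fiso_conj P s : P \subset S -> s \in S -> fiso F P (P :^ s)%G (conjg^~ s).
Proof.
move=> sPS Ss; apply: (@fiso_intro _ _ S) => //.
by apply: fmor_conj => //; rewrite -(conjGid Ss) conjSg.
Qed.

Lemma fiso_inv P Q f : fiso F P Q f ->
  exists g, [/\ fiso F Q P g, {in P, cancel f g} & {in Q, cancel g f}].
Proof.
case/andP=> Ff /eqP fP; have [_ [g Fg fK]] := fmor_fact Ff fP.
exists g; split=> //; last by move=> y; rewrite -fP => /imsetP[x Px ->]; rewrite fK.
apply: fiso_intro Fg _; rewrite -fP -imset_comp -[RHS]imset_id.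
by apply: eq_in_imset => x Px /=; rewrite fK.
Qed.

Lemma fiso_comp P Q R f g :
  fiso F P Q f -> fiso F Q R g -> fiso F P R (g \o f).
Proof.
case/andP=> Ff /eqP fP /andP[Fg /eqP gQ].
by rewrite /fiso (fmor_comp Ff Fg) imset_comp fP gQ eqxx.
Qed.

Lemma fiso_card P Q f : fiso F P Q f -> #|P| = #|Q|.
Proof.
by case/andP=> Ff /eqP <-; rewrite card_in_imset //; apply: fmor_inj Ff.
Qed.

Lemma fiso_subS P Q f : fiso F P Q f -> P \subset S /\ Q \subset S.
Proof. by case/andP=> /fmor_sub. Qed.

Lemma fmor_fiso P Q f :
  F P Q f -> exists R : {group gT}, [/\ fiso F P R f, R \subset Q & R \subset S].
Proof.
move=> Ff; have [R fP] := fmor_img Ff (subxx P).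
exists R; split; first exact: fiso_intro Ff fP.
  by case: (fmor_injhom Ff) => _ _; rewrite fP.
by have [] := fiso_subS (fiso_intro Ff fP).
Qed.

Lemma fiso_ext P Q f g : {in P, f =1 g} -> fiso F P Q f -> fiso F P Q g.
Proof.
move=> fg /andP[Ff /eqP fP]; apply: fiso_intro (fmor_ext fg Ff) _.
by rewrite -fP; apply/esym/eq_in_imset.
Qed.

Lemma Aut_fusionP P a :
  reflect (a \in Aut P /\ F P P a) (a \in Aut_fusion F P).
Proof. exact: setIdP. Qed.

Lemma Aut_fusion_group_set P : P \subset S -> group_set (Aut_fusion F P).
Proof.
move=> sPS; apply/group_setP; split=> [|a b /Aut_fusionP[Aa Fa] /Aut_fusionP[Ab Fb]].
  apply/Aut_fusionP; rewrite group1; split=> //.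
  by apply: fmor_ext (fmor_id (subxx P) sPS) => x _; rewrite perm1.
apply/Aut_fusionP; rewrite groupM //; split=> //.
by apply: fmor_ext (fmor_comp Fa Fb) => x _; rewrite permM.
Qed.

Lemma fmor_aut P f : F P P f -> exists2 a, a \in Aut_fusion F P & {in P, f =1 a}.
Proof.
move=> Ff; have [mf injf sfP] := fmor_injhom Ff.
exists (perm_in injf sfP); last by move=> x Px; rewrite perm_inE.
rewrite !inE; apply/andP; split; last first.
  by apply: fmor_ext Ff => x Px; rewrite perm_inE.
apply/andP; split; first exact: perm_in_on.
by apply/morphicP=> x y Px Py; rewrite !perm_inE ?groupM // (fmorM Ff).
Qed.

Lemma Aut_fusion_img P a : a \in Aut P -> a @: P = P.
Proof.
rewrite inE => /andP[/im_perm_on] //.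
Qed.

(* Morphisms are total functions, so a property of morphisms can only be
   decided after replacing them by finite functions. *)
Definition fconj P Q : bool := [exists f : {ffun gT -> gT}, fiso F P Q f].

Lemma fconjP P Q : reflect (exists f, fiso F P Q f) (fconj P Q).
Proof.
apply: (iffP existsP) => [[f Ff]|[f Ff]]; first by exists f.
by exists (finfun f); apply: fiso_ext Ff => x _; rewrite ffunE.
Qed.

Lemma fconj_refl P : P \subset S -> fconj P P.
Proof. by move=> sPS; apply/fconjP; exists id; apply: fiso_id. Qed.

Lemma fconj_sym P Q : fconj P Q -> fconj Q P.
Proof. by case/fconjP=> f /fiso_inv[g [Fg _ _]]; apply/fconjP; exists g. Qed.

Lemma fconj_trans P Q R : fconj P Q -> fconj Q R -> fconj P R.
Proof.
case/fconjP=> f Ff /fconjP[g Fg]; apply/fconjP; exists (g \o f).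
exact: fiso_comp Ff Fg.
Qed.

Lemma fully_normalized_exists P : P \subset S ->
  exists Q f, fiso F P Q f /\ fully_normalized F Q.
Proof.
move=> sPS.
have [Q PQ maxQ] := @arg_maxnP _ P (fconj P) (fun Q => #|'N_S(Q)|) (fconj_refl sPS).
have /fconjP[f Ff] := PQ; exists Q, f; split=> // R g Fg; apply: maxQ.
by apply: fconj_trans PQ _; apply/fconjP; exists g.
Qed.

Lemma centric_fiso P Q f : centric F P -> fiso F P Q f -> centric F Q.
Proof. by move=> cP Ff R g Fg; apply: (cP R (g \o f)); apply: fiso_comp Ff Fg. Qed.

Lemma centric_sub P Q : centric F P -> P \subset Q -> Q \subset S -> centric F Q.
Proof.
move=> cP sPQ sQS R f Ff; have FfR := fiso_mor Ff.
have [P' fP] := fmor_img FfR sPQ.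
have FfP: fiso F P P' f by apply: fiso_intro (fmor_sub_restr FfR sPQ fP) fP.
have sP'R: P' \subset R by rewrite -fP -(fiso_img Ff) imsetS.
by apply: subset_trans (subset_trans (cP _ _ FfP) sP'R); rewrite setIS ?centS.
Qed.

Lemma centric_cent P : centric F P -> P \subset S -> 'C_S(P) = 'Z(P).
Proof.
move=> cP sPS; apply/eqP; rewrite eqEsubset [X in _ && X]setSI // andbT.
by rewrite subsetI subsetIr (cP P id) ?fiso_id.
Qed.

Lemma fiso_center P Q f : fiso F P Q f -> f @: 'Z(P) = 'Z(Q).
Proof.
move=> Ff; have FfP := fiso_mor Ff; have [mf injf _] := fmor_injhom FfP.
have injm: 'injm (morphm mf) by apply/injmP.
rewrite -(fiso_img Ff) -[f @: P]/(morphm mf @: P) -[f @: 'Z(P)]/(morphm mf @: 'Z(P)).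
have sZP: 'Z(P) \subset P by apply: subsetIl.
by rewrite -!morphimEsub // injm_center.
Qed.

Lemma fiso_card_center P Q f : fiso F P Q f -> #|'Z(P)| = #|'Z(Q)|.
Proof.
move=> Ff; rewrite -(fiso_center Ff) card_in_imset // => x y /setIP[Px _] /setIP[Py _].
exact: fmor_inj (fiso_mor Ff) _ _ Px Py.
Qed.

Lemma centric_fully_centralized P : centric F P -> P \subset S -> fully_centralized F P.
Proof.
move=> cP sPS Q f Ff; have [_ sQS] := fiso_subS Ff.
by rewrite !centric_cent ?(fiso_card_center Ff) //; apply: centric_fiso Ff.
Qed.

End FusionBasics.

(** * Consequences of saturation *)

Section Saturation.

Variables (p : nat) (gT : finGroupType) (S : {group gT}) (F : fusion_system S).
Hypotheses (pS : p.-group S) (satF : saturated p F).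
Implicit Types P Q R A B : {group gT}.

Lemma Aut_by_sub R : R \subset S -> Aut_by S R \subset Aut_fusion F R.
Proof.
move=> sRS; apply/subsetP=> _ /morphimP[s nRs /setIP[Ss _] ->].
apply/Aut_fusionP; split; first by rewrite (subsetP (Aut_conj_aut R 'N(R))) ?mem_morphim.
have: F R R (conjg^~ s) by apply: fmor_conj; rewrite ?(normP nRs).
by apply: fmor_ext => x Rx; rewrite norm_conj_autE.
Qed.

(** Transported along f, A becomes a p-subgroup of Aut_F(Q), in which Aut_S(Q) is a Sylow subgroup
    because Q is fully normalized. Composing f with an automorphism d that conjugates the
    transported group into Aut_S(Q) gives g. *)
Lemma realize_pgroup R Q (A : {group {perm gT}}) f :
  fully_normalized F Q -> fiso F R Q f -> p.-group A -> A \subset Aut_fusion F R ->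
  exists2 g, fiso F R Q g &
    {in A, forall a : {perm gT}, exists2 s, s \in 'N_S(Q) & {in R, forall x, g (a x) = g x ^ s}}.
Proof.
move=> nQ Ff pA sAF; have [sRS sQS] := fiso_subS Ff.
have [_ sylQ] := satF.1 Q sQS nQ.
have [mf injf0 _] := fmor_injhom (fiso_mor Ff).
have injf : 'injm (morphm mf) by apply/injmP.
pose c := Aut_isom injf (subxx R).
have sAA: A \subset Aut R by apply/subsetP=> a /(subsetP sAF)/Aut_fusionP[].
have cE a x : a \in A -> x \in R -> c a (f x) = f (a x).
  by move=> Aa Rx; apply: (Aut_isomE injf (subxx R) (subsetP sAA a Aa) Rx).
pose B := (Aut_isom_morphism injf (subxx R) @* A)%G.
have sBF: B \subset Group (Aut_fusion_group_set F sQS).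
  apply/subsetP=> _ /morphimP[a _ Aa ->]; apply/Aut_fusionP; split.
    have := Aut_Aut_isom injf (subxx R) a; rewrite morphimEsub //=.
    by rewrite -[morphm mf @: R]/(f @: R) (fiso_img Ff).
  have [_ Fa] := Aut_fusionP _ _ _ (subsetP sAF a Aa).
  have [g [Fg fK gK]] := fiso_inv Ff.
  have := fmor_comp (fmor_comp (fiso_mor Fg) Fa) (fiso_mor Ff).
  apply: fmor_ext => y Qy; have Rgy := fmor_in (fiso_mor Fg) Qy.
  by rewrite /= -cE // gK.
have pB: p.-group B by apply: morphim_pgroup.
have [|d Fd sBd] := @Sylow_Jsub p _ (Group (Aut_fusion_group_set F sQS))
  (conj_aut Q @* 'N_S(Q))%G B _ sBF pB; first exact: sylQ.
have [Ad FQd] := Aut_fusionP _ _ _ Fd.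
have Fd': fiso F Q Q d by apply: fiso_intro FQd (Aut_fusion_img Ad).
exists (d \o f); first exact: fiso_comp Ff Fd'.
move=> a Aa; have Bca: c a \in B by apply: mem_morphim => //; apply: subsetP Aa.
have /(subsetP sBd)/morphimP[s nQs Ss Es] : c a ^ d \in B :^ d by rewrite memJ_conjg.
exists s => // x Rx /=; have Qfx := fmor_in (fiso_mor Ff) Rx.
rewrite -(norm_conj_autE nQs (fmor_in FQd Qfx)).
by rewrite -Es /= conjgE !permM permK cE.
Qed.

Lemma realize_paut R a : R \subset S -> a \in Aut_fusion F R -> p.-elt a ->
  exists Q f s, [/\ fiso F R Q f, s \in 'N_S(Q) & {in R, forall x, f (a x) = f x ^ s}].
Proof.
move=> sRS Fa pa; have [Q [f [Ff nQ]]] := fully_normalized_exists F sRS.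
have [|g Fg gA] := @realize_pgroup R Q <[a]>%G f nQ Ff pa.
  by rewrite -[Aut_fusion F R]/(gval (Group (Aut_fusion_group_set F sRS))) cycle_subG.
by have [s Ns gs] := gA a (cycle_id a); exists Q, g, s.
Qed.

(** With A = Aut_S(R) in [realize_pgroup], every element of N_S(R) lies in the extender of the
    modified isomorphism, which therefore extends to N_S(R). Only the image Q of f is kept, not its
    values. *)
Lemma extend_norm R Q f : fully_normalized F Q -> fiso F R Q f ->
  exists2 g, F 'N_S(R)%G S g & g @: R = Q.
Proof.
move=> nQ Ff; have [sRS sQS] := fiso_subS Ff.
have [cQ _] := satF.1 Q sQS nQ.
have pA: p.-group (conj_aut R @* 'N_S(R))%G.
  by apply: morphim_pgroup; apply: pgroupS pS; apply: subsetIl.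
have [g Fg gA] := realize_pgroup nQ Ff pA (Aut_by_sub sRS).
have [|D [h [ED Fh gh]]] := satF.2 R Q g _ (fiso_img Fg) cQ.
  exact: fmor_resS (fiso_mor Fg) (subxx R).
have EN: 'N_S(R)%G = D.
  apply/val_inj/eqP; rewrite /= ED eqEsubset; apply/andP; split; last first.
    by apply/subsetP=> s; rewrite inE => /andP[].
  apply/subsetP=> s Ns; rewrite inE Ns /=.
  have nRs: s \in 'N(R) by case/setIP: Ns.
  have [|t Nt gt] := gA (conj_aut R s); first exact: mem_morphim.
  apply/exists_inP; exists t => //; apply/forall_inP=> x Rx.
  by rewrite -gt // norm_conj_autE.
by exists h; rewrite ?EN // -(fiso_img Fg); apply/esym/eq_in_imset.
Qed.

(* A morphism fixing Q pointwise moves r to z r with z in Z(Q), hence has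
   p-power order and becomes conjugation by some s in a suitable conjugate of
   R; as s centralizes the conjugate of Q, it comes from Z(Q). *)
Lemma centric_fix_conj Q R f : centric F Q -> Q \subset R -> R \subset 'N(Q) ->
  F R S f -> {in Q, forall x, f x = x} ->
  exists2 z, z \in 'Z(Q) & {in R, forall x, f x = x ^ z}.
Proof.
move=> cQ sQR nQR Ff fQ; have sRS := fmor_subl Ff; have sQS := subset_trans sQR sRS.
have fZ r : r \in R -> f r * r^-1 \in 'Z(Q).
  move=> Rr; rewrite -(centric_cent cQ sQS) inE groupM ?groupV ?(fmor_in Ff) ?(subsetP sRS) //=.
  apply/centP=> x Qx; apply/commute_sym/commgP/conjg_fixP.
  have Qxr: x ^ r \in Q by rewrite memJ_norm ?(subsetP nQR).
  have Rx := subsetP sQR _ Qx.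
  by rewrite conjgM -{1}(fQ _ Qx) -(fmorJ Ff) // fQ // conjgK.
have sZQ: 'Z(Q) \subset Q by apply: subsetIl.
have FRf: F R R f.
  apply: (fmor_res Ff (subxx R) sRS); apply/subsetP=> _ /imsetP[r Rr ->].
  by rewrite -(mulgKV r (f r)) groupM // (subsetP sQR) // (subsetP sZQ) // fZ.
have [a Fa fa] := fmor_aut FRf; have [Aa _] := Aut_fusionP _ _ _ Fa.
have aX i r : r \in R -> (a ^+ i) r = (f r * r^-1) ^+ i * r.
  move=> Rr; have Qz := subsetP sZQ _ (fZ r Rr).
  elim: i => [|i IHi]; first by rewrite expg0 perm1 mul1g.
  rewrite expgSr permM IHi -fa ?groupM ?groupX ?(subsetP sQR _ Qz) //.
  rewrite (fmorM Ff) ?groupX ?(subsetP sQR _ Qz) //.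
  by rewrite fQ ?groupX // expgSr -mulgA mulgKV.
(* By [aX] the powers of a multiply r by powers of an element of Z(Q), and the exponent |S| kills
   these. *)
have pa: p.-elt a.
  apply: pnat_dvd (pS); rewrite order_dvdn; apply/eqP.
  apply: (@eq_Aut _ R); rewrite ?group1 ?groupX // => r Rr.
  rewrite aX // perm1 expg_cardG ?mul1g //.
  by rewrite (subsetP sQS) // (subsetP sZQ) // fZ.
have [T [g [s [Fg Ns gs]]]] := realize_paut sRS Fa pa.
have FgT := fiso_mor Fg; have [Q' gQ] := fmor_img FgT sQR.
have FgQ: fiso F Q Q' g.
  by apply: fiso_intro (fmor_resS FgT sQR) gQ.
have : s \in 'Z(Q').
  rewrite -(centric_cent (centric_fiso cQ FgQ)) ?(fiso_subS FgQ) //; last by case: (fiso_subS FgQ).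
  case/setIP: Ns => Ss _; rewrite inE Ss -gQ; apply/centP=> _ /imsetP[x Qx ->].
  apply/commute_sym/commgP/conjg_fixP; have Rx := subsetP sQR _ Qx.
  by rewrite -gs // -fa // fQ.
rewrite -(fiso_center FgQ) => /imsetP[z Zz Es]; exists z => // x Rx.
have Rz: z \in R by apply/(subsetP sQR)/(subsetP sZQ).
apply: (fmor_inj FgT); rewrite ?groupJ ?(fmor_in FRf) //.
by rewrite fa // gs // Es -(fmorJ FgT).
Qed.

(** The map g f^-1 on f(R) fixes f(Q) pointwise, and f(Q) is again centric, so [centric_fix_conj]
    applies to it. *)
Lemma centric_ext_conj Q R f g : centric F Q -> Q \subset R -> R \subset 'N(Q) ->
  F R S f -> F R S g -> {in Q, f =1 g} ->
  exists z, [/\ z \in S, {in Q, forall x, commute (f x) z} & {in R, forall x, g x = f x ^ z}].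
Proof.
move=> cQ sQR nQR Ff Fg fg; have [R' fR] := fmor_img Ff (subxx R).
have [Q' fQ] := fmor_img Ff sQR.
have [h [Fh fK hK]] := fiso_inv (fiso_intro Ff fR).
have FfQ : fiso F Q Q' f by apply: fiso_intro (fmor_resS Ff sQR) fQ.
have sQ'S : Q' \subset S by case: (fiso_subS FfQ).
have nQR' : R' \subset 'N(Q').
  apply/subsetP=> y; rewrite -fR => /imsetP[r Rr ->]; rewrite inE.
  apply/subsetP=> z; rewrite -fQ => /imsetP[_ /imsetP[x Qx ->] ->].
  by rewrite -(fmorJ Ff) ?(subsetP sQR _ Qx) // imset_f // memJ_norm // (subsetP nQR).
have [||||| z Zz gz] := @centric_fix_conj Q' R' (g \o h).
- exact: centric_fiso cQ FfQ.
- by rewrite -fR -fQ imsetS.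
- by [].
- exact: fmor_comp (fiso_mor Fh) Fg.
- move=> y; rewrite -fQ => /imsetP[x Qx ->] /=.
  by rewrite fK ?(subsetP sQR) // fg.
have [Qz cQz] := setIP Zz.
exists z; split=> [|x Qx|x Rx]; first exact: subsetP Qz.
- by apply/commute_sym/(centP cQz); rewrite -fQ imset_f.
- by rewrite -gz /= ?fK // -fR imset_f.
Qed.

Lemma extender_sub Q Q' f : F Q S f -> f @: Q = Q' -> Q \subset extender S Q Q' f.
Proof.
move=> Ff fQ; have sQS := fmor_subl Ff; apply/subsetP=> q Qq.
apply/setIdP; split; first by rewrite inE (subsetP sQS) // (subsetP (normG Q)).
apply/exists_inP; exists (f q).
  by rewrite -fQ inE (fmor_in Ff) //= fQ (subsetP (normG Q')) // -fQ imset_f.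
by apply/forall_inP=> x Qx; rewrite (fmorJ Ff).
Qed.

End Saturation.

(** * Fixed points of bisets *)

Lemma card_partition_sum (T I : finType) (B : {set T}) (A : {set I}) (C : I -> {set T}) :
  (forall x, x \in B -> exists2 i, i \in A & x \in C i) ->
  (forall i, i \in A -> C i \subset B) ->
  (forall i j x, i \in A -> j \in A -> x \in C i -> x \in C j -> i = j) ->
  #|B| = \sum_(i in A) #|C i|.
Proof.
move=> coverB sCB tiC; under eq_bigr do rewrite -sum1_card.
rewrite -sum1_card (exchange_big_dep (mem B)) /= => [|i x Ai /(subsetP (sCB i Ai))//].
apply: eq_bigr => x /coverB[i Ai Cx].
rewrite (bigD1 i) ?Ai //= big1 ?addn0 // => j /andP[/andP[Aj Cjx] nji].
by case/eqP: nji; apply: tiC Cjx Cx.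
Qed.

Notation bfix X Q f := 'Fix_(bact X)(graph Q f).

Section Graphs.

Variables (gT : finGroupType) (T : {group gT}) (X : biset T).
Implicit Types (Q R : {group gT}) (f g : gT -> gT) (x y : X).

Lemma graphP (Q : {set gT}) f b a : reflect (a \in Q /\ b = f a) ((b, a) \in graph Q f).
Proof.
apply: (iffP imsetP) => [[c Qc [-> ->]] | [Qa ->]]; first by [].
by exists a.
Qed.

Lemma eq_graph (Q : {set gT}) f g : {in Q, f =1 g} -> graph Q f = graph Q g.
Proof. by move=> fg; apply: eq_in_imset => a Qa; rewrite fg. Qed.

Lemma card_graph (Q : {set gT}) f : #|graph Q f| = #|Q|.
Proof. by apply: card_imset => a b [_]. Qed.

Lemma graph_sub (Q : {set gT}) f : Q \subset T -> f @: Q \subset T -> graph Q f \subset setX T T.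
Proof.
move=> sQT sfT; apply/subsetP=> -[b a] /graphP[Qa ->]; apply/setXP.
by split; [apply: (subsetP sfT); apply: imset_f | apply: subsetP Qa].
Qed.

Lemma graph_subP (Q R : {set gT}) f g :
  reflect (Q \subset R /\ {in Q, f =1 g}) (graph Q f \subset graph R g).
Proof.
apply: (iffP subsetP) => [sQR | [sQR fg] [b a] /graphP[Qa ->]].
  have H a: a \in Q -> (a \in R) /\ f a = g a.
    by move=> Qa; apply/graphP; apply: sQR; apply/graphP.
  by split=> [|a /H[]//]; apply/subsetP=> a /H[].
by apply/graphP; rewrite (subsetP sQR) // fg.
Qed.

Lemma bfixP (Q : {set gT}) f x :
  reflect {in Q, forall a, bact X x (f a, a) = x} (x \in bfix X Q f).
Proof.
apply: (iffP afixP) => [xQ a Qa | xQ [b a] /graphP[Qa ->]]; last exact: xQ.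
by apply: xQ; apply/graphP.
Qed.

Lemma fix_bstab x (H : {set gT * gT}) : H \subset setX T T ->
  (x \in 'Fix_(bact X)(H)) = (H \subset bstab x).
Proof.
move=> sHT; apply/afixP/subsetP => [xH u Hu | sH u /sH/bstabP[]//].
by apply/bstabP; rewrite (subsetP sHT) // xH.
Qed.

Lemma bact_left_inj x b c : b \in T -> c \in T ->
  bact X x (b, 1) = bact X x (c, 1) -> b = c.
Proof.
move=> Tb Tc xbc; apply/eqP; rewrite eq_mulgV1; apply/eqP.
apply: (@bact_freel _ _ X x); first by rewrite groupM ?groupV.
have ->: (b * c^-1, 1) = (b, 1) * (c, 1)^-1 :> gT * gT.
  by congr (_, _); rewrite /= invg1 mulg1.
by rewrite actMin ?inE ?groupV /= ?Tb ?Tc ?group1 // xbc actKin // inE /= Tc group1.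
Qed.

Lemma bfix_left (Q : {set gT}) f x b : Q \subset T -> f @: Q \subset T -> b \in T ->
  x \in bfix X Q f -> bact X x (b, 1) \in bfix X Q (fun a => f a ^ b).
Proof.
move=> sQT sfT Tb /bfixP xQ; apply/bfixP=> a Qa.
have Tfa : f a \in T by rewrite (subsetP sfT) ?imset_f.
have Ta := subsetP sQT _ Qa.
rewrite -{2}(xQ a Qa) -!actMin ?inE /= ?groupJ ?Tb ?Ta ?Tfa ?group1 //.
by congr (bact X x _); congr (_, _); rewrite /= ?mul1g ?mulg1 ?conjgE ?mulKVg.
Qed.

Lemma bfix_left_cent (Q : {set gT}) f x b : Q \subset T -> f @: Q \subset T ->
  b \in T -> {in Q, forall a, commute (f a) b} ->
  x \in bfix X Q f -> bact X x (b, 1) \in bfix X Q f.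
Proof.
move=> sQT sfT Tb cfb xQ; have := bfix_left sQT sfT Tb xQ.
rewrite (@eq_graph _ (fun a => f a ^ b) f) // => a /cfb fb.
by apply/conjg_fixP/commgP.
Qed.

Section LeftOrbit.

Variables (Q : {set gT}) (f : gT -> gT) (C : {set gT}).
Hypotheses (sQT : Q \subset T) (sfT : f @: Q \subset T) (sCT : C \subset T).
Hypothesis cfC : {in C, forall z, {in Q, forall a, commute (f a) z}}.

Lemma left_orbit_sub x : x \in bfix X Q f -> [set bact X x (z, 1) | z in C] \subset bfix X Q f.
Proof.
move=> Qx; apply/subsetP=> _ /imsetP[z Cz ->].
by apply: bfix_left_cent => //; [apply: subsetP Cz | apply: cfC].
Qed.

Lemma card_left_orbit x : #|[set bact X x (z, 1) | z in C]| = #|C|.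
Proof.
by apply: card_in_imset => b c Cb Cc; apply: bact_left_inj; apply: (subsetP sCT).
Qed.

(** Left translation is free, so an orbit of C already has |C| points; a fixed-point set that is no
    larger is that orbit. *)
Lemma left_orbit_transitive x y : #|bfix X Q f| <= #|C| ->
  x \in bfix X Q f -> y \in bfix X Q f -> exists2 z, z \in C & y = bact X x (z, 1).
Proof.
move=> leQC Qx; have /eqP<- : [set bact X x (z, 1) | z in C] == bfix X Q f.
  by rewrite eqEcard left_orbit_sub // card_left_orbit.
by case/imsetP=> z; exists z.
Qed.

Lemma card_single_left_orbit x : x \in bfix X Q f ->
  (forall y, y \in bfix X Q f -> exists2 z, z \in C & y = bact X x (z, 1)) ->
  #|bfix X Q f| = #|C|.
Proof.
move=> Qx Cx; rewrite -(card_left_orbit x); congr #|pred_of_set _|.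
apply/eqP; rewrite eqEsubset left_orbit_sub // andbT; apply/subsetP=> y /Cx[z Cz ->].
exact: imset_f.
Qed.

End LeftOrbit.

End Graphs.

(** * Numerical criteria for semicharacteristic and characteristic bisets *)

Section Semicharacteristic.

Variables (gT : finGroupType) (T : {group gT}) (G : fusion_system T) (X : biset T).
Implicit Types (Q R : {group gT}) (f g : gT -> gT) (x y : X).

Lemma fmor_imgT Q f : G Q T f -> f @: Q \subset T.
Proof. by case/fmor_injhom. Qed.

(** The stabilizer of a fixed point is the graph of a morphism that extends f. *)
Lemma generated_fix Q f x : generated_biset G X -> Q \subset T -> f @: Q \subset T ->
  x \in bfix X Q f -> G Q T f.
Proof.
move=> genX sQT sfT; rewrite fix_bstab; last exact: graph_sub.
have [R [g [Gg ->]]] := genX x; case/graph_subP=> sQR fg.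
by apply: fmor_ext (fmor_resS Gg sQR) => a /fg.
Qed.

Lemma stable_fix Q f : stable_biset G X -> G Q T f -> #|bfix X Q f| = #|bfix X Q id|.
Proof.
move=> stX Gf; have sQT := fmor_subl Gf; have [R [Gf' _ _]] := fmor_fiso Gf.
have inj_id : injhom Q T id by apply: fmor_injhom (fmor_id G sQT (subxx T)).
rewrite (stX _ _ _ _ id id f sQT inj_id (imset_id Q) (fiso_id G sQT) Gf').
by congr #|pred_of_set 'Fix_(_)(_)|; apply: eq_graph.
Qed.

Lemma stable_fix_fiso Q R f : stable_biset G X -> fiso G Q R f ->
  #|bfix X Q id| = #|bfix X R id|.
Proof.
move=> stX Gf; have [sQT sRT] := fiso_subS Gf.
have inj_id : injhom R T id by apply: fmor_injhom (fmor_id G sRT (subxx T)).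
rewrite (stX _ _ _ _ id f id sRT inj_id (imset_id R) Gf (fiso_id G sRT)).
rewrite -(stable_fix stX (fmor_resS (fiso_mor Gf) (subxx Q))).
by congr #|pred_of_set 'Fix_(_)(_)|; apply: eq_graph.
Qed.

(** Stability only has to be checked for morphisms: if f is not one, neither is its composite with
    isomorphisms of G, and a generated biset has no fixed points for either graph. *)
Lemma semichar_intro (c : {group gT} -> nat) : generated_biset G X ->
  (forall Q R f, fiso G Q R f -> c Q = c R) ->
  (forall Q f, G Q T f -> #|bfix X Q f| = c Q) -> semichar_biset G X.
Proof.
move=> genX cG cX; split=> // Q Q' D R f h1 h2 sQT injf fQ Gh1 Gh2.
have sfT : f @: Q \subset T by case: injf.
have [Gf | nGf] := boolP (G Q T f).
  have Gff : fiso G Q D f by apply: fiso_intro Gf fQ.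
  have Gh := fiso_comp (fiso_comp Gh1 Gff) Gh2.
  by rewrite !cX ?(cG _ _ _ Gh1) //; apply: fmor_resS (fiso_mor Gh) (subxx _).
have -> : bfix X Q f = set0.
  by apply/setP=> x; rewrite in_set0; apply: contraNF nGf; apply: generated_fix.
suff -> : bfix X Q' (h2 \o f \o h1) = set0 by rewrite !cards0.
have [sQ'T _] := fiso_subS Gh1; have [_ sRT] := fiso_subS Gh2.
have him : (h2 \o f \o h1) @: Q' = R.
  by rewrite imset_comp (fiso_img Gh1) imset_comp fQ (fiso_img Gh2).
apply/setP=> x; rewrite in_set0; apply: contraNF nGf => Q'x.
have Gh : G Q' T (h2 \o f \o h1).
  by apply: (generated_fix genX sQ'T _ Q'x); rewrite him.
have [g1 [Gg1 h1K g1K]] := fiso_inv Gh1; have [g2 [Gg2 h2K g2K]] := fiso_inv Gh2.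
have Gh' : fiso G Q' R (h2 \o f \o h1) by apply: fiso_intro Gh him.
have := fiso_comp (fiso_comp Gg1 Gh') Gg2 => /fiso_mor Gg.
apply: fmor_ext (fmor_resS Gg (subxx Q)) => a Qa /=.
by rewrite g1K // h2K // -fQ imset_f.
Qed.

(* Orbits whose stabilizers are graphs over a proper subgroup of T have order
   divisible by p |T|. *)
Lemma semichar_card p : prime p -> p.-group T -> semichar_biset G X ->
  #|X| = #|Aut_fusion G T| * #|bfix X T id| %[mod p * #|T|].
Proof.
move=> pr_p pT [genX stX].
(* Since X is generated, the points with stabilizer of order |T| are those fixed by the graph of an
   automorphism in Aut_G(T); by stability each automorphism contributes |X^T| of them. *)
pose B := [set x : X | #|bstab x| == #|T|].
have fixB x : x \in B -> exists2 a, a \in Aut_fusion G T & x \in bfix X T a.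
  rewrite inE; have [Q [f [Gf stx]]] := genX x; rewrite stx card_graph => cardQ.
  have ET : Q :=: T by apply/eqP; rewrite eqEcard (fmor_subl Gf) (eqP cardQ) /=.
  have {}ET : Q = T by apply/val_inj.
  rewrite {}ET in Gf stx; have [a Ga fa] := fmor_aut Gf; exists a => //.
  rewrite fix_bstab; last first.
    by apply: graph_sub => //; rewrite Aut_fusion_img //; case/Aut_fusionP: Ga.
  by rewrite stx; apply/graph_subP; split=> // y Ty; rewrite fa.
have fixB1 x a : a \in Aut_fusion G T -> x \in bfix X T a -> bstab x = graph T a.
  case/Aut_fusionP=> Aa Ga; have sTa : a @: T \subset T by rewrite Aut_fusion_img.
  rewrite fix_bstab ?graph_sub //.
  have [Q [f [Gf ->]]] := genX x; case/graph_subP=> sTQ af.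
  have {Gf} ET : Q = T by apply/val_inj/eqP; rewrite eqEsubset (fmor_subl Gf).
  by rewrite ET; apply/esym/eq_graph.
have cardB : #|B| = (#|Aut_fusion G T| * #|bfix X T id|)%N.
  rewrite -sum_nat_const -(eq_bigr _ (fun a Ga => stable_fix stX (Aut_fusionP _ _ _ Ga).2)).
  apply: card_partition_sum => [x /fixB//|a Ga|a b x Ga Gb xa xb].
    by apply/subsetP=> x /(fixB1 x a Ga) stx; rewrite inE stx card_graph.
  have [[Aa _] [Ab _]] := (Aut_fusionP _ _ _ Ga, Aut_fusionP _ _ _ Gb).
  apply: (eq_Aut Aa Ab) => y Ty.
  have /graph_subP[_ -> //] : graph T a \subset graph T b.
  by rewrite -(fixB1 x a Ga xa) -(fixB1 x b Gb xb).
rewrite -[#|X|]cardsT -(cardsID B) setTI cardB setTD -[X in _ = X %[mod _]]addn0.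
apply/eqP; rewrite eqn_modDl mod0n; apply/eqP/eqP.
have actsB : [acts setX T T, on ~: B | bact X].
  apply/subsetP=> u Tu; rewrite inE Tu inE; apply/subsetP=> x.
  by rewrite !inE bstab_act // cardJg.
rewrite -(acts_sum_card_orbit actsB); apply: dvdn_sum => _ /imsetP[x nBx ->].
rewrite card_orbit_in // -divgS ?subsetIl // cardsX.
move: nBx; rewrite !inE => nTx.
have [Q [f [Gf stx]]] := genX x; have sQT := fmor_subl Gf.
rewrite stx card_graph in nTx *.
rewrite -[X in _ %/ X]/#|bstab x| stx card_graph -{3}(Lagrange sQT) mulnCA mulKn //.
rewrite [X in _ %| X]mulnC dvdn_pmul2r //.
have /p_natP[[|k] Ek] : p.-nat #|T : Q| by apply: pnat_dvd (dvdn_indexg T Q) pT.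
  by case/eqP: nTx; rewrite -(Lagrange sQT) Ek muln1.
by rewrite Ek expnS dvdn_mulr.
Qed.

(** With no such point, [semichar_card] makes p |T| divide |X|, so p divides |X| / |T|. *)
Lemma char_fix_card p : prime p -> p.-group T -> char_biset p G X -> 0 < #|bfix X T id|.
Proof.
move=> pr_p pT [scX]; rewrite lt0n; apply: contra => /eqP fix0.
have := semichar_card pr_p pT scX; rewrite fix0 muln0 mod0n => /eqP.
rewrite -/(_ %| _) => /dvdnP[m ->].
by rewrite mulnA mulnK // modnMl mod0n.
Qed.

(** The equality |Inn(T)| |Z(T)| = |T| turns the congruence of [semichar_card] into |X| = |Aut_G(T)
    : Inn(T)| |T| modulo p |T|, and this index is prime to p. *)
Lemma char_criterion p : prime p -> p.-group T -> p.-Sylow(Aut_fusion G T) (Inn T) ->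
  semichar_biset G X -> #|bfix X T id| = #|'Z(T)| -> char_biset p G X.
Proof.
move=> pr_p pT /and3P[sIA _ p'A] scX fixZ; split=> //.
have := semichar_card pr_p pT scX; rewrite fixZ.
have cardI : (#|Inn T| * #|'Z(T)| = #|T|)%N.
  have := card_morphim (conj_aut T) T; rewrite ker_conj_aut.
  rewrite (setIidPr (normG T)) => ->; rewrite -/(center T) mulnC.
  by rewrite -indexgI Lagrange ?subsetIl.
rewrite -(Lagrange (G := Group (Aut_fusion_group_set G (subxx T)))
  (H := (conj_aut T @* T)%G) sIA) /= -/(Inn T) mulnAC cardI.
set k := #|_ : _|; move=> EX.
rewrite (divn_eq #|X| (p * #|T|)) EX (mulnC #|T|) -muln_modl mulnA -mulnDl mulnK //.
rewrite modnMDl modn_mod mod0n -/(dvdn p k).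
by apply: contraL p'A => pk; rewrite p'natE // -/k pk.
Qed.

End Semicharacteristic.

(** * Adding orbits to a biset *)

Section Unions.

Variables (gT : finGroupType) (T : {group gT}) (I : finType) (B : I -> biset T).

Lemma bunion_fixE (x : bunion B) (H : {set gT * gT}) :
  (x \in 'Fix_(bact (bunion B))(H)) = (tagged x \in 'Fix_(bact (B (tag x)))(H)).
Proof.
apply/afixP/afixP => xH u /xH; first exact: bunion_actK.
by case: x {xH} => i x /= xu; rewrite /bunion_act /= xu.
Qed.

Lemma card_bunion_fix (H : {set gT * gT}) :
  #|'Fix_(bact (bunion B))(H)| = \sum_i #|'Fix_(bact (B i))(H)|.
Proof.
under eq_bigr do rewrite -sum1_card.
rewrite sig_big_dep -sum1_card; apply: eq_bigl => x.
exact: bunion_fixE.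
Qed.

Lemma bunion_bstab (x : bunion B) : bstab x = bstab (tagged x : B (tag x)).
Proof.
apply/setP=> u; apply/bstabP/bstabP => -[Tu xu]; split=> //.
  exact: bunion_actK.
by case: x xu => i x /= xu; rewrite /bunion_act /= xu.
Qed.

Lemma bunion_generated (G : fusion_system T) :
  (forall i, generated_biset G (B i)) -> generated_biset G (bunion B).
Proof. by move=> gB [i x]; rewrite bunion_bstab; apply: gB. Qed.

End Unions.

(** * Transitive bisets *)

Section CosetBiset.

Variables (gT : finGroupType) (T : {group gT}) (D : {group gT * gT}).
Hypotheses (sDT : D \subset setX T T) (Dl : forall b, (b, 1) \in D -> b = 1)
  (Dr : forall a, (1, a) \in D -> a = 1).

Local Notation carrier := {C : {set gT * gT} | C \in rcosets D (setX T T)}.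

Lemma coset_biset_dom :
  setX T T \subset subact_dom (mem (rcosets D (setX T T))) 'Rs.
Proof.
apply/subsetP=> u Tu; rewrite !inE; apply/subsetP=> C; rewrite !inE.
case/rcosetsP=> v Tv ->; rewrite /= rcosetE -rcosetM.
by apply/rcosetsP; exists (v * u); rewrite ?groupM.
Qed.

Definition coset_biset_action : action (setX T T) carrier :=
  ('Rs^? \ coset_biset_dom)%act.

Lemma coset_biset_actE (C : carrier) u : u \in setX T T ->
  val (coset_biset_action C u) = val C :* u.
Proof. by move=> Tu; rewrite ractE val_subact (subsetP coset_biset_dom) //= rcosetE. Qed.

Lemma coset_biset_fixed (C : carrier) u : u \in setX T T ->
  coset_biset_action C u = C -> exists2 g, g \in setX T T & u \in D :^ g.
Proof.
move=> Tu /(congr1 val); rewrite coset_biset_actE //.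
case/rcosetsP: (valP C) => g Tg -> DguDg; exists g => //.
have : g * u \in D :* g.
  by rewrite -DguDg -rcosetM rcoset_refl.
by rewrite mem_rcoset mem_conjg conjgE invgK mulgA.
Qed.

Lemma coset_biset_freel (C : carrier) b :
  b \in T -> coset_biset_action C (b, 1) = C -> b = 1.
Proof.
move=> Tb /coset_biset_fixed[|[g1 g2] Tg]; first by rewrite inE Tb group1.
rewrite mem_conjg => Db.
have /Dl/eqP : (b ^ g1^-1, 1) \in D.
  by move: Db; congr (_ \in D); congr (_, _); rewrite /= mul1g invgK mulgV.
by rewrite conjg_eq1 => /eqP.
Qed.

Lemma coset_biset_freer (C : carrier) a :
  a \in T -> coset_biset_action C (1, a) = C -> a = 1.
Proof.
move=> Ta /coset_biset_fixed[|[g1 g2] Tg]; first by rewrite inE Ta group1.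
rewrite mem_conjg => Da.
have /Dr/eqP : (1, a ^ g2^-1) \in D.
  by move: Da; congr (_ \in D); congr (_, _); rewrite /= mul1g invgK mulgV.
by rewrite conjg_eq1 => /eqP.
Qed.

(** The orbit T x T / D, realized on right cosets because bisets are right actions. Stabilizers are
    conjugates of D, and the conditions on D pass to its conjugates, which gives freeness. *)
Definition coset_biset : biset T := Biset coset_biset_freel coset_biset_freer.

Lemma coset_biset_bstab (C : coset_biset) :
  exists2 g, g \in setX T T & bstab C = D :^ g.
Proof.
case/rcosetsP: (valP C) => g Tg EC; exists g => //.
apply/setP=> u; apply/bstabP/idP => [[Tu /(congr1 val)]|].
  rewrite coset_biset_actE // EC => DguDg.
  have : g * u \in D :* g by rewrite -DguDg -rcosetM rcoset_refl.
  by rewrite mem_rcoset mem_conjg conjgE invgK mulgA.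
move=> Du; have Tu : u \in setX T T.
  by rewrite -(conjGid Tg); apply: subsetP Du; rewrite conjSg.
split=> //; apply: val_inj; rewrite coset_biset_actE // EC -rcosetM.
apply/rcoset_eqP; rewrite mem_rcoset.
by move: Du; rewrite mem_conjg conjgE invgK mulgA.
Qed.

(** D fixes the coset D g exactly when g normalizes D. *)
Lemma coset_biset_fix_self :
  #|'Fix_(bact coset_biset)(D)| = #|'N_(setX T T)(D) : D|.
Proof.
rewrite /indexg -(afixRs_rcosets (setX T T) D) -(card_imset _ val_inj).
congr #|pred_of_set _|; apply/setP=> C; apply/imsetP/setIP => [[E DE ->]|[TC DC]].
  split; first exact: valP E.
  apply/afixP=> u Du; move/afixP: DE => /(_ u Du)/(congr1 val).
  by rewrite coset_biset_actE ?(subsetP sDT) //= rcosetE.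
exists (Sub C TC : carrier) => //; apply/afixP=> u Du; apply: val_inj.
by rewrite coset_biset_actE ?(subsetP sDT) //= -rcosetE; move/afixP: DC; apply.
Qed.

End CosetBiset.

Lemma bfixJ (gT : finGroupType) (T : {group gT}) (X : biset T) (H : {set gT * gT}) g :
  H \subset setX T T -> g \in setX T T ->
  #|'Fix_(bact X)(H :^ g)| = #|'Fix_(bact X)(H)|.
Proof.
move=> sHT Tg; rewrite -(card_imset 'Fix_(bact X)(H) (@act_inj _ _ _ (bact X) g)).
congr #|pred_of_set _|; have sHgT : H :^ g \subset setX T T by rewrite -(conjGid Tg) conjSg.
apply/setP=> x; apply/idP/imsetP => [|[y yH ->]].
  move=> xH; exists (bact X x g^-1); last by rewrite actKVin.
  rewrite !fix_bstab // in xH *.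
  by rewrite bstab_act ?groupV // -sub_conjg.
by rewrite !fix_bstab // in yH *; rewrite bstab_act // conjSg.
Qed.

Section AddOrbits.

Variables (gT : finGroupType) (S : {group gT}) (F : fusion_system S).

Definition fusion_graph (D : {set gT * gT}) : bool :=
  [exists Q : {group gT}, [exists f : {ffun gT -> gT}, F Q S f && (D == graph Q f)]].

Lemma fusion_graphP (D : {set gT * gT}) :
  reflect (exists (Q : {group gT}) f, F Q S f /\ D = graph Q f) (fusion_graph D).
Proof.
apply: (iffP existsP) => [[Q /existsP[f /andP[Ff /eqP]]]|[Q [f [Ff ->]]]].
  by exists Q, f.
exists Q; apply/existsP; exists (finfun f).
have Ef : {in Q, f =1 finfun f} by move=> x _; rewrite ffunE.
by rewrite (fmor_ext Ef Ff) (eq_graph Ef) eqxx.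
Qed.

Lemma fusion_graph_sub D : fusion_graph D -> D \subset setX S S.
Proof. by case/fusion_graphP=> Q [f [Ff ->]]; rewrite graph_sub ?(fmor_subl Ff) ?(fmor_imgT Ff). Qed.

Lemma graph_group_set (Q R : {group gT}) f : F Q R f -> group_set (graph Q f).
Proof.
move=> Ff; apply/group_setP; split=> [|[b a] [d c]].
  by apply/graphP; rewrite (fmor1 Ff).
by case/graphP=> Qa -> /graphP[Qc ->]; apply/graphP; rewrite groupM // -(fmorM Ff).
Qed.

Lemma fusion_graphJ D g : fusion_graph D -> g \in setX S S -> fusion_graph (D :^ g).
Proof.
case: g => m n; case/fusion_graphP=> Q [f [Ff ->]] /setXP[Sm Sn].
have sQS := fmor_subl Ff; apply/fusion_graphP.
exists (Q :^ n)%G, (conjg^~ m \o f \o conjg^~ n^-1); split.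
  have sQnS : (Q :^ n)%G \subset S by rewrite -(conjGid Sn) conjSg.
  have F1 : F (Q :^ n)%G Q (conjg^~ n^-1).
    by apply: fmor_conj; rewrite ?groupV // -conjsgM mulgV conjsg1.
  have F2 : F S S (conjg^~ m) by apply: fmor_conj; rewrite ?conjGid.
  exact: fmor_comp (fmor_comp F1 Ff) F2.
apply/setP=> -[b a]; rewrite mem_conjg.
have -> : (b, a) ^ (m, n)^-1 = (b ^ m^-1, a ^ n^-1) by [].
apply/graphP/graphP => -[].
  by rewrite -mem_conjg => Qa fa; split=> //=; rewrite -fa conjgKV.
by rewrite mem_conjg => Qa ->; split=> //=; rewrite conjgK.
Qed.

Lemma fusion_graph_gen Q f : F Q S f -> exists2 D : {group gT * gT}, D :=: graph Q f & fusion_graph D.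
Proof.
move=> Ff; exists (Group (graph_group_set Ff)) => //.
by apply/fusion_graphP; exists Q, f.
Qed.

Lemma fusion_graph_left D b : fusion_graph D -> (b, 1) \in D -> b = 1.
Proof. by case/fusion_graphP=> Q [f [Ff ->]] /graphP[_ ->]; apply: fmor1 Ff. Qed.

Lemma fusion_graph_right D a : fusion_graph D -> (1, a) \in D -> a = 1.
Proof.
case/fusion_graphP=> Q [f [Ff ->]] /graphP[Qa /esym fa].
by apply: (fmor_inj Ff) => //; rewrite fa (fmor1 Ff).
Qed.

Variables (X : biset S) (n : nat) (t : {group gT * gT} -> nat).
Hypotheses (genX : generated_biset F X) (ltX : forall x : X, n < #|bstab x|).
Hypothesis tJ : forall (D : {group gT * gT}) g, g \in setX S S -> t (D :^ g)%G = t D.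
Hypothesis tX : forall D : {group gT * gT}, fusion_graph D -> #|D| = n ->
  #|'Fix_(bact X)(D)| <= t D /\ #|'N_(setX S S)(D) : D| %| t D - #|'Fix_(bact X)(D)|.

(** The conjugacy classes of graphs D of order n can be treated independently: one orbit S x S / D
    adds |N(D) : D| points fixed by D, and none fixed by a subgroup of order at least n outside the
    class of D. The multiplicity [m] is the deficit divided by this index, an integer by [tX]. *)
Lemma add_orbits : exists Y : biset S,
  [/\ generated_biset F Y, forall y : Y, n <= #|bstab y|,
      forall D : {group gT * gT}, fusion_graph D -> #|D| = n -> #|'Fix_(bact Y)(D)| = t D &
      forall H : {set gT * gT}, H \subset setX S S -> n < #|H| ->
        #|'Fix_(bact Y)(H)| = #|'Fix_(bact X)(H)|].
Proof.
pose Dn := [set D : {group gT * gT} | fusion_graph D && (#|D| == n)].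
have actsDn : [acts setX S S, on Dn | 'JG].
  apply/subsetP=> g Sg; rewrite !inE; apply/subsetP=> D; rewrite !inE /=.
  by case/andP=> tD cD; rewrite fusion_graphJ // cardJg.
have [_ sOD orbO repO] := orbit_transversalP actsDn.
set O := orbit_transversal _ _ _ in sOD orbO repO.
pose m (D : {group gT * gT}) :=
  (t D - #|'Fix_(bact X)(D)|) %/ #|'N_(setX S S)(D) : D|.
pose I := {D : {group gT * gT} | D \in O}.
have OD (i : I) : fusion_graph (val i) /\ #|val i| = n.
  by have := subsetP sOD _ (valP i); rewrite inE => /andP[tD /eqP].
pose C (i : I) : biset S := @coset_biset _ _ _
  (fun b => @fusion_graph_left _ b (OD i).1) (fun a => @fusion_graph_right _ a (OD i).1).
pose C' (j : {i : I & 'I_(m (val i))}) := C (tag j).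
pose Y := bunion (fun b : bool => if b then X else bunion C').
have stabC i (x : C i) : exists2 g, g \in setX S S & bstab x = val i :^ g.
  by apply: coset_biset_bstab; apply: fusion_graph_sub (OD i).1.
have fixY (H : {set gT * gT}) : #|'Fix_(bact Y)(H)| =
    (#|'Fix_(bact X)(H)| + \sum_(i : I) m (val i) * #|'Fix_(bact (C i))(H)|)%N.
  apply: etrans (card_bunion_fix _ H) _; rewrite big_bool; congr (_ + _)%N.
  apply: etrans (card_bunion_fix _ H) _.
  rewrite (eq_bigr (fun i : I => \sum_(j < m (val i)) #|'Fix_(bact (C i))(H)|)).
    by rewrite sig_big_dep.
  by move=> i _; rewrite sum_nat_const card_ord.
have fixC i (H : {set gT * gT}) : H \subset setX S S -> n <= #|H| ->
    0 < #|'Fix_(bact (C i))(H)| -> exists2 g, g \in setX S S & H = val i :^ g.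
  move=> sHS leH /card_gt0P[x]; rewrite fix_bstab //.
  have [g Sg ->] := stabC i x => sHD; exists g => //.
  by apply/eqP; rewrite eqEcard sHD cardJg (OD i).2.
exists Y; split.
- apply: bunion_generated => -[] //; apply: bunion_generated => -[i k] x.
  have [g Sg stx] := stabC i x; have /fusion_graphP[Q [f [Ff Ef]]] := fusion_graphJ (OD i).1 Sg.
  by exists Q, f; rewrite -Ef.
- move=> y; rewrite bunion_bstab; case: y => -[x|[[i k] x]] /=; first exact: ltnW.
  rewrite bunion_bstab /=.
  by have [g Sg ->] := stabC i x; rewrite cardJg (OD i).2.
- move=> D tD cD; rewrite fixY; have sDS := fusion_graph_sub tD.
  have [|g Sg OgD] := repO D; first by rewrite inE tD cD eqxx.
  pose i0 : I := exist (fun E : {group gT * gT} => E \in O) (D :^ g)%G OgD.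
  rewrite (bigD1 i0) //= big1 ?addn0 => [|i ni0]; last first.
    apply/eqP; rewrite muln_eq0; apply/orP; right; apply: contraR ni0.
    rewrite -lt0n => /fixC[||h Sh ED]; rewrite ?cD //.
    rewrite -val_eqE eq_sym /= -orbO ?(valP i) //; apply/orbitP.
    exists (g^-1 * h^-1); first by rewrite groupM ?groupV.
    by apply: val_inj; rewrite /= -conjsgM mulKVg ED -conjsgM mulgV conjsg1.
  have [tg cg] : fusion_graph (D :^ g) /\ #|D :^ g| = n by rewrite fusion_graphJ // cardJg.
  have [le_t dv_t] := @tX (D :^ g)%G tg cg.
  rewrite -(bfixJ (C i0) sDS Sg) (coset_biset_fix_self (fusion_graph_sub (OD i0).1)).
  by rewrite divnK // -(bfixJ X sDS Sg) subnKC // tJ.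
- move=> H sHS ltH; have leH := ltnW ltH; rewrite fixY big1 ?addn0 // => i _.
  apply/eqP; rewrite muln_eq0; apply/orP; right; apply: contraLR ltH.
  by rewrite -lt0n -leqNgt => /(fixC i H sHS leH)[g Sg ->]; rewrite cardJg (OD i).2.
Qed.

End AddOrbits.

(** * A characteristic biset with few fixed points on centric subgroups *)

(** Burnside's orbit counting for M on the points fixed by D; among these, the points fixed by h are
    those fixed by D and h together. *)
Lemma burnside_dvd (gT : finGroupType) (S : {group gT}) (X : biset S) (D M : {group gT * gT}) :
  D \subset M -> M \subset 'N(D) -> M \subset setX S S ->
  #|M| %| \sum_(h in M) #|'Fix_(bact X)(D <*> <[h]>)|.
Proof.
move=> sDM nDM sMS; have sDS := subset_trans sDM sMS.
have actM : [acts M, on 'Fix_(bact X)(D) | bact X].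
  have := acts_subnorm_fix (bact X) D; rewrite (setIidPr sDS).
  by apply: subset_trans; rewrite subsetI sMS.
rewrite (eq_bigr (fun h => #|'Fix_('Fix_(bact X)(D) | bact X)[h]|)).
  by rewrite (Frobenius_Cauchy actM) dvdn_mull.
move=> h Mh; have Sh := subsetP sMS _ Mh.
by rewrite afixYin ?cycle_subG // afix_cycle_in.
Qed.

Section Stabilization.

Variables (p : nat) (gT : finGroupType) (S : {group gT}) (F : fusion_system S).
Hypotheses (pS : p.-group S) (satF : saturated p F).
Implicit Types (P Q R A B : {group gT}) (D E M : {group gT * gT}).

Lemma norm_graphP Q f b a : F Q S f ->
  reflect [/\ b \in S, a \in S, a \in 'N(Q) & {in Q, forall x, f (x ^ a) = f x ^ b}]
          ((b, a) \in 'N_(setX S S)(graph Q f)).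
Proof.
move=> Ff; apply: (iffP setIP) => [[/setXP[Sb Sa]]|[Sb Sa nQa fab]].
  rewrite inE => /subsetP nD.
  have H x : x \in Q -> x ^ a \in Q /\ f x ^ b = f (x ^ a).
    move=> Qx; apply/graphP; have -> : (f x ^ b, x ^ a) = (f x, x) ^ (b, a) by [].
    by apply/nD/imset_f/graphP.
  split=> // [|x /H[]//]; rewrite inE; apply/subsetP=> _ /imsetP[x /H[Qx _] ->] //.
split; first exact/setXP.
rewrite inE; apply/subsetP=> _ /imsetP[[d c] /graphP[Qc ->] ->].
have -> : (f c, c) ^ (b, a) = (f c ^ b, c ^ a) by [].
by apply/graphP; rewrite memJ_norm // fab.
Qed.

Lemma norm_img_graph Q Q' f b a : F Q S f -> f @: Q = Q' ->
  (b, a) \in 'N_(setX S S)(graph Q f) -> b \in 'N_S(Q').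
Proof.
move=> Ff fQ /(norm_graphP _ _ Ff)[Sb Sa nQa fab]; rewrite inE Sb -fQ inE.
apply/subsetP=> _ /imsetP[_ /imsetP[x Qx ->] ->]; rewrite -fab //.
by rewrite imset_f ?memJ_norm.
Qed.

Lemma norm_sub_extender Q Q' R f g : F R S g -> Q \subset R -> {in Q, f =1 g} ->
  f @: Q = Q' -> 'N_R(Q) \subset extender S Q Q' f.
Proof.
move=> Fg sQR fg fQ; apply/subsetP=> r /setIP[Rr nQr].
have gJ : {in Q, forall x, f (x ^ r) = f x ^ g r}.
  by move=> x Qx; rewrite !fg ?memJ_norm // (fmorJ Fg) // (subsetP sQR).
apply/setIdP; split; first by rewrite inE nQr (subsetP (fmor_subl Fg)).
apply/exists_inP; exists (g r); last by apply/forall_inP=> x Qx; rewrite gJ.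
rewrite inE (fmor_in Fg) //= -fQ inE; apply/subsetP=> _ /imsetP[_ /imsetP[x Qx ->] ->].
by rewrite -gJ // imset_f ?memJ_norm.
Qed.

(** If (b, a) normalizes the graph, then b witnesses that a lies in the extender, so a is in Q and b
    differs from f(a) by an element of C_S(Q'). The normalizer is thus the product of C_S(Q') x 1
    and D. *)
Lemma index_norm_graph Q Q' f D : F Q S f -> f @: Q = Q' -> D :=: graph Q f ->
  extender S Q Q' f = Q -> #|'N_(setX S S)(D) : D| = #|'C_S(Q')|.
Proof.
move=> Ff fQ ED eQ; have sDS : D \subset setX S S.
  by rewrite ED graph_sub ?(fmor_subl Ff) ?(fmor_imgT Ff).
have sDN : D \subset 'N_(setX S S)(D) by rewrite subsetI sDS normG.
pose C := setX_group 'C_S(Q')%G [1 gT]%G.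
have EN : 'N_(setX S S)(D) = C * D.
  apply/setP=> -[b a]; apply/idP/mulsgP => [Nba|].
    have Nba' : (b, a) \in 'N_(setX S S)(graph Q f) by rewrite -ED.
    have Nb := norm_img_graph Ff fQ Nba'.
    have [Sb Sa nQa fab] := norm_graphP _ _ Ff Nba'.
    have Qa : a \in Q.
      rewrite -eQ; apply/setIdP; split; first by rewrite inE Sa.
      by apply/exists_inP; exists b => //; apply/forall_inP=> x Qx; rewrite fab.
    have Sfa := fmor_in Ff Qa.
    exists (b * (f a)^-1, 1) (f a, a).
    - apply/setXP; split; last exact: group1.
      rewrite inE groupM ?groupV //= -fQ; apply/centP=> _ /imsetP[x Qx ->].
      apply/commute_sym/commgP/conjg_fixP.
      by rewrite conjgM -fab // (fmorJ Ff) // conjgK.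
    - by rewrite ED; apply/graphP.
    - by congr (_, _); rewrite /= ?mulgKV ?mul1g.
  case=> -[z y] [d c] /setXP[/setIP[Sz Cz] /set1P-> {y}]; rewrite ED => /graphP[Qc ->] ->.
  have -> : (z, 1) * (f c, c) = (z * f c, c) by congr (_, _); rewrite /= mul1g.
  apply/(norm_graphP _ _ Ff); split.
  - by rewrite groupM ?(fmor_in Ff).
  - exact: subsetP (fmor_subl Ff) _ Qc.
  - by rewrite (subsetP (normG Q)).
  move=> x Qx; rewrite (fmorJ Ff) // conjgM; congr (_ ^ _); apply/esym/conjg_fixP/commgP.
  by apply: commute_sym; apply: (centP Cz); rewrite -fQ imset_f.
have tiCD : C :&: D = 1.
  apply/trivgP/subsetP=> -[b a] /setIP[/setXP[_ /set1P->]].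
  by rewrite ED => /graphP[_ ->]; rewrite (fmor1 Ff) inE.
have cardC : #|C| = #|'C_S(Q')| by rewrite cardsX cards1 muln1.
by rewrite -divgS //= EN TI_cardMg // mulnK // cardC.
Qed.

(** Invariant of the descending construction: only orbits with stabilizers of order greater than n
    have been placed, and the fixed-point numbers of subgroups of such order are already final. *)
Definition stable_above n (X : biset S) : Prop :=
  [/\ generated_biset F X, forall x : X, n < #|bstab x|,
      forall Q R f g h, n < #|Q| -> F Q S f -> F R S g -> fiso F Q R h ->
        #|bfix X Q f| = #|bfix X R g| &
      forall Q f, n < #|Q| -> centric F Q -> F Q S f -> #|bfix X Q f| = #|'Z(Q)|].

(* Let f extend to its extender E. If E = Q, no point is fixed and one orbit
   S x S / (Q, f) supplies the missing |Z(Q)| points. Otherwise a point fixed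
   by the graph of the extension is fixed by (Q, f), and by centric_ext_conj
   every other point fixed by (Q, f) is a left translate of it by an element
   of Z(f(Q)). *)
Lemma centric_level n (X : biset S) Q f D : stable_above n X ->
  centric F Q -> F Q S f -> #|Q| = n -> D :=: graph Q f ->
  #|bfix X Q f| <= #|'Z(Q)| /\ #|'N_(setX S S)(D) : D| %| #|'Z(Q)| - #|bfix X Q f|.
Proof.
case=> genX ltX _ cX cQ Ff cardQ ED.
have sQS := fmor_subl Ff; have [Q' fQ] := fmor_img Ff (subxx Q).
have FfQ : fiso F Q Q' f := fiso_intro Ff fQ.
have [_ sQ'S] := fiso_subS FfQ; have cQ' := centric_fiso cQ FfQ.
have sfS : f @: Q \subset S by rewrite fQ.
have [E [g [EE Fg fg]]] := satF.2 Q Q' f Ff fQ (centric_fully_centralized cQ' sQ'S).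
have sQE : Q \subset E by rewrite EE; apply: (extender_sub Ff fQ).
have sEN : E \subset 'N_S(Q) by rewrite EE; apply/subsetP=> x /setIdP[].
have [sES nQE] := subsetIP sEN.
have stabX x : x \in bfix X Q f -> exists (R : {group gT}) h,
    [/\ bstab x = graph R h, F R S h, Q \proper 'N_R(Q), 'N_R(Q) \subset E & {in Q, f =1 h}].
  rewrite fix_bstab ?graph_sub //; have [R [h [Fh stx]]] := genX x.
  rewrite stx => /graph_subP[sQR fh]; exists R, h; split=> //.
    apply: nilpotent_proper_norm; first by apply: pgroup_nil (pgroupS (fmor_subl Fh) pS).
    by rewrite properEcard sQR -(card_graph R h) -stx cardQ ltX.
  by rewrite EE; apply: norm_sub_extender Fh sQR fh fQ.
have [EQ|nEQ] := eqVneq (E : {set gT}) Q.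
  have -> : bfix X Q f = set0.
    apply/setP=> x; rewrite in_set0; apply/negP=> /stabX[R [h [_ _ prN sNE _]]].
    by have := proper_sub_trans prN sNE; rewrite EQ properxx.
  rewrite cards0 subn0 (index_norm_graph Ff fQ ED) -?EE //.
  by rewrite (centric_cent cQ' sQ'S) (fiso_card_center FfQ) dvdnn.
have ltE : n < #|E| by rewrite -cardQ proper_card // properEneq eq_sym nEQ.
have cE := centric_sub cQ sQE sES.
have [y yE] : exists y, y \in bfix X E g.
  by apply/card_gt0P; rewrite (cX E g ltE cE Fg) cardG_gt0.
have yQ : y \in bfix X Q f.
  by apply/bfixP=> a Qa; rewrite fg //; apply: (bfixP _ _ _ yE); apply: (subsetP sQE).
suff -> : #|bfix X Q f| = #|'Z(Q')| by rewrite (fiso_card_center FfQ) subnn leqnn dvdn0.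
have sZS : 'Z(Q') \subset S by apply: subset_trans (center_sub _) sQ'S.
apply: (card_single_left_orbit sQS sfS sZS _ yQ) => [z /setIP[_ cz] a Qa|x xQ].
  by apply/commute_sym/(centP cz); rewrite -fQ imset_f.
have [R [h [stx Fh prN sNE fh]]] := stabX x xQ.
(* The domain R of the stabilizer of x need neither lie in E nor normalize Q. N_R(Q) does both and,
   being larger than Q, is covered by the invariant. On it h is g followed by conjugation by z, so x
   and the translate of y by z lie in one fixed-point set, which is a single orbit of a center. *)
pose R1 := 'N_R(Q)%G; have sQR1 : Q \subset R1 by apply: proper_sub.
have sR1R : R1 \subset R by apply: subsetIl.
have Fg1 := fmor_resS Fg sNE; have Fh1 := fmor_resS Fh sR1R.
have sR1S := fmor_subl Fh1.
have [||z [Sz cz hz]] := centric_ext_conj pS satF cQ sQR1 _ Fg1 Fh1.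
- exact: subsetIr.
- by move=> a Qa; rewrite -fg // fh.
have y1 : y \in bfix X R1 g.
  by apply/bfixP=> a R1a; apply: (bfixP _ _ _ yE); apply: (subsetP sNE).
have y2 : bact X y (z, 1) \in bfix X R1 h.
  rewrite (eq_graph hz); apply: bfix_left => //; exact: fmor_imgT Fg1.
have x1 : x \in bfix X R1 h.
  rewrite fix_bstab ?graph_sub ?(fmor_imgT Fh1) // stx; apply/graph_subP; split=> //.
have ltR1 : n < #|R1| by rewrite -cardQ proper_card.
have [R2 hR1] := fmor_img Fh1 (subxx R1).
have FhR : fiso F R1 R2 h := fiso_intro Fh1 hR1.
have [|||||w Zw ->] := @left_orbit_transitive _ _ X R1 h 'Z(R2) _ _ _ _ _ x _ y2 x1.
- by [].
- exact: fmor_imgT Fh1.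
- by apply: subset_trans (center_sub _) _; case: (fiso_subS FhR).
- move=> w /setIP[_ cw] a R1a; apply/commute_sym/(centP cw).
  by rewrite -hR1 imset_f.
- by rewrite -(fiso_card_center FhR) (cX R1 h ltR1 (centric_sub cQ sQR1 sR1S) Fh1).
have Sw : w \in S.
  by move: Zw => /setIP[R2w _]; apply: subsetP R2w; case: (fiso_subS FhR).
exists (z * w).
  rewrite -(centric_cent cQ' sQ'S) inE groupM //= -fQ.
  apply/centP=> _ /imsetP[a Qa ->]; apply: commute_sym; apply: commuteM.
    by rewrite fg //; apply: cz.
  have /setIP[_ cw] := Zw; apply/commute_sym/(centP cw).
  by rewrite fh // -hR1 imset_f // (subsetP sQR1).
rewrite -actMin ?inE /= ?Sz ?Sw ?group1 //; congr (bact X y _).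
by congr (_, _); rewrite /= mulg1.
Qed.

(** A subgroup fixing a point lies in the graph of a morphism, hence is the graph of a restriction
    of it. *)
Lemma fix_fusion_graph (X : biset S) x E : generated_biset F X -> E \subset setX S S ->
  x \in 'Fix_(bact X)(E) -> fusion_graph F E.
Proof.
move=> genX sES; rewrite fix_bstab //; have [R [g [Fg ->]]] := genX x => sER.
have inE' u : u \in E -> u.2 \in R /\ u.1 = g u.2.
  by case: u => b a /(subsetP sER)/graphP.
pose Q := (snd @* E)%G.
have EQ : Q :=: [set u.2 | u in E] by rewrite /= morphimEsub ?subsetT.
have sQR : Q \subset R by rewrite EQ; apply/subsetP=> _ /imsetP[u /inE'[Ru _] ->].
apply/fusion_graphP; exists Q, g; split; first exact: fmor_resS Fg sQR.
apply/setP=> -[b a]; rewrite /graph EQ; apply/idP/imsetP => [Eu|[_ /imsetP[u Eu ->] ->]].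
  by have [_ /= ->] := inE' _ Eu; exists a => //; apply/imsetP; exists (b, a).
by have [_ <-] := inE' u Eu; case: u Eu.
Qed.

Lemma graph_transport A A' B B' R f h k : fiso F A A' h -> fiso F B B' k ->
  F R S f -> R \subset A -> f @: R \subset B ->
  exists R' f', [/\ fiso F R R' h, F R' S f' &
    [set (k u.1, h u.2) | u in graph R f] = graph R' f'].
Proof.
move=> Fh Fk Ff sRA sfB; have [h' [Fh' hK h'K]] := fiso_inv Fh.
have [R' hR] := fmor_img (fiso_mor Fh) sRA.
have FhR : fiso F R R' h by apply: (fiso_intro (fmor_resS (fiso_mor Fh) sRA) hR).
have sR'A' : R' \subset A' by rewrite -hR -(fiso_img Fh) imsetS.
have FR : F R B f by apply: (fmor_res Ff (subxx R)) sfB; case: (fiso_subS Fk).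
have Fh'R : F R' R h'.
  apply: (fmor_res (fiso_mor Fh')) => //; first exact: fmor_subl Ff.
  apply/subsetP=> _ /imsetP[y R'y ->]; move: R'y; rewrite -hR => /imsetP[x Rx ->].
  by rewrite hK // (subsetP sRA).
exists R', (k \o f \o h'); split=> //.
  exact: fmor_resS (fmor_comp Fh'R (fmor_comp FR (fiso_mor Fk))) (subxx R').
rewrite /graph -hR -!imset_comp; apply: eq_in_imset => x Rx /=.
by rewrite hK // (subsetP sRA).
Qed.

(* phi is (b, a) |-> (k b, g a), where k extends an isomorphism f(Q) -> Q0 to
   N_S(f(Q)) and g extends k f; an element a occurring in the normalizer lies
   in the extender of k f, its witness being k b. *)
Lemma norm_transport n (X : biset S) Q Q0 f h D : stable_above n X ->
  F Q S f -> D :=: graph Q f -> fully_normalized F Q0 -> fiso F Q Q0 h ->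
  exists phi : {morphism 'N_(setX S S)(D) >-> gT * gT}, [/\ 'injm phi,
    phi @* 'N_(setX S S)(D) \subset setX S S,
    phi @* D = graph Q0 id &
    forall E, E \subset 'N_(setX S S)(D) -> n < #|E| ->
      #|'Fix_(bact X)(E)| = #|'Fix_(bact X)(phi @* E)|].
Proof.
case=> genX _ stX _ Ff ED nQ0 Fh; set M := 'N_(setX S S)(D).
have [sQS sQ0S] := fiso_subS Fh.
have [Q' fQ] := fmor_img Ff (subxx Q).
have [f' [Ff' fK f'K]] := fiso_inv (fiso_intro Ff fQ).
have [k Fk kQ'] := extend_norm pS satF nQ0 (fiso_comp Ff' Fh).
have sQ'S : Q' \subset S by case: (fiso_subS Ff').
have sQ'N : Q' \subset 'N_S(Q') by rewrite subsetI sQ'S normG.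
have FQN : F Q 'N_S(Q')%G f.
  by apply: (fmor_res Ff (subxx Q)); rewrite ?subsetIl // fQ.
have Fkf : F Q S (k \o f) := fmor_comp FQN Fk.
have kfQ : (k \o f) @: Q = Q0 by rewrite imset_comp fQ.
have [A [g [EA Fg gk]]] := satF.2 Q Q0 _ Fkf kfQ (satF.1 Q0 sQ0S nQ0).1.
have inM b a : (b, a) \in M -> b \in 'N_S(Q') /\ a \in A.
  rewrite /M ED => Mba; have Nb := norm_img_graph Ff fQ Mba; split=> //.
  have [Sb Sa nQa fab] := norm_graphP _ _ Ff Mba; rewrite EA.
  apply/setIdP; split; first by rewrite inE Sa.
  have Q'J x : x \in Q -> f x \in 'N_S(Q').
    by move=> Qx; apply: (subsetP sQ'N); rewrite -fQ imset_f.
  apply/exists_inP; exists (k b); last first.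
    by apply/forall_inP=> x Qx; rewrite /= fab // (fmorJ Fk) // Q'J.
  rewrite inE (fmor_in Fk) //= -kfQ inE; apply/subsetP=> _ /imsetP[_ /imsetP[x Qx ->] ->].
  by rewrite /= -(fmorJ Fk) ?Q'J // -fab // -[k _]/((k \o f) _) imset_f ?memJ_norm.
pose phi (u : gT * gT) := (k u.1, g u.2).
have phiM : {in M &, {morph phi : u v / u * v}}.
  move=> [b a] [d c] /inM[Nb Aa] /inM[Nd Ac].
  by congr (_, _); rewrite /= ?(fmorM Fk) ?(fmorM Fg).
have phi_inj : {in M &, injective phi}.
  move=> [b a] [d c] /inM[Nb Aa] /inM[Nd Ac] [/(fmor_inj Fk)-> // /(fmor_inj Fg)-> //].
pose phim : {morphism M >-> gT * gT} := Morphism phiM.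
have sDM : D \subset M.
  by rewrite subsetI normG andbT ED graph_sub // (fmor_imgT Ff).
exists phim; split.
- exact/injmP.
- rewrite morphimEdom; apply/subsetP=> _ /imsetP[[b a] /inM[Nb Aa] ->].
  by apply/setXP; rewrite (fmor_in Fk) ?(fmor_in Fg).
- transitivity (phi @: graph Q f); first by rewrite -ED morphimEsub.
  rewrite /graph -imset_comp -kfQ -[RHS]imset_comp.
  by apply: eq_in_imset => x Qx /=; rewrite /phi /= -gk.
move=> E sEM ltE; have sES : E \subset setX S S by apply: subset_trans sEM (subsetIl _ _).
have [A' [Fg' _ sA'S]] := fmor_fiso Fg.
have [B' [Fk' _ sB'S]] := fmor_fiso Fk.
have EphiE : phim @* E = [set (k u.1, g u.2) | u in E] by rewrite morphimEsub.
have sphiES : phim @* E \subset setX S S.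
  rewrite morphimEsub //; apply/subsetP=> _ /imsetP[[b a] /(subsetP sEM)/inM[Nb Aa] ->].
  by apply/setXP; rewrite (fmor_in Fk) ?(fmor_in Fg).
have fgE : fusion_graph F E -> fusion_graph F (phim @* E) /\
    #|'Fix_(bact X)(E)| = #|'Fix_(bact X)(phim @* E)|.
  case/fusion_graphP=> R [r [Fr ER]].
  have [sRA sRB] : R \subset A /\ r @: R \subset 'N_S(Q').
    split; apply/subsetP.
      by move=> a Ra; have /(subsetP sEM)/inM[] : (r a, a) \in E by rewrite ER; apply/graphP.
    move=> _ /imsetP[a Ra ->].
    by have /(subsetP sEM)/inM[] : (r a, a) \in E by rewrite ER; apply/graphP.
  have [R' [r' [FgR Fr' Er']]] := graph_transport Fg' Fk' Fr sRA sRB.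
  rewrite EphiE ER Er'; split; first by apply/fusion_graphP; exists R', r'.
  by apply: (stX _ _ _ _ g) => //; rewrite -(card_graph R r) -ER.
have fgE' : fusion_graph F (phim @* E) -> fusion_graph F E.
  case/fusion_graphP=> R [r [Fr ER]].
  have [k' [FBk kK k'K]] := fiso_inv Fk'; have [g' [FAg gK g'K]] := fiso_inv Fg'.
  have inE' u : u \in R -> exists b a, [/\ (b, a) \in E, r u = k b & u = g a].
    move=> Ru; have : (r u, u) \in phim @* E by rewrite ER; apply/graphP.
    by rewrite EphiE => /imsetP[[b a] Eba [-> ->]]; exists b, a.
  have [||R' [r' [_ Fr' Er']]] := graph_transport FAg FBk Fr.
  - apply/subsetP=> u /inE'[b [a [/(subsetP sEM)/inM[_ Aa] _ ->]]].
    by rewrite -(fiso_img Fg') imset_f.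
  - apply/subsetP=> _ /imsetP[u /inE'[b [a [/(subsetP sEM)/inM[Nb _] -> _]]] ->].
    by rewrite -(fiso_img Fk') imset_f.
  apply/fusion_graphP; exists R', r'; split=> //.
  rewrite -Er' -ER EphiE -imset_comp -[LHS]imset_id.
  apply: eq_in_imset => -[b a] /(subsetP sEM)/inM[Nb Aa] /=.
  by rewrite kK ?gK.
(* A subgroup that is not the graph of a morphism fixes no point, and by [fgE'] neither does its
   image. *)
have [/fgE[]//|nfE] := boolP (fusion_graph F E).
have -> : 'Fix_(bact X)(E) = set0.
  apply/setP=> x; rewrite in_set0; apply: contraNF nfE; exact: fix_fusion_graph.
suff -> : 'Fix_(bact X)(phim @* E) = set0 by rewrite !cards0.
apply/setP=> x; rewrite in_set0; apply: contraNF nfE => /(@fix_fusion_graph _ _ (phim @* E)%G).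
by move=> H; apply: fgE'; apply: H.
Qed.

(* Any number congruent to |X^Q0| modulo |S x S| and large enough will do for
   the class of Q: the divisibility follows by subtracting the Burnside counts
   of orbits of the normalizer on X^(Q,f) and, through norm_transport, on
   X^Q0, whose terms agree outside the graph itself. *)
Lemma noncentric_level n (X : biset S) Q Q0 f h D : stable_above n X ->
  F Q S f -> #|Q| = n -> D :=: graph Q f -> fully_normalized F Q0 -> fiso F Q Q0 h ->
  let c := (#|bfix X Q0 id| + #|X| * #|setX S S|)%N in
  #|bfix X Q f| <= c /\ #|'N_(setX S S)(D) : D| %| c - #|bfix X Q f|.
Proof.
move=> stX Ff cardQ ED nQ0 Fh c; set M := 'N_(setX S S)(D).
have le_c : #|bfix X Q f| <= c.
  apply: leq_trans (max_card _) _; apply: leq_trans (leq_addl _ _).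
  by rewrite leq_pmulr // cardG_gt0.
split=> //; have [phi [injphi sphiS phiD fixphi]] := norm_transport stX Ff ED nQ0 Fh.
have sMS : M \subset setX S S by apply: subsetIl.
have sDM : D \subset M.
  by rewrite subsetI normG andbT ED graph_sub ?(fmor_subl Ff) ?(fmor_imgT Ff).
have nDM : M \subset 'N(D) by apply: subsetIr.
have := burnside_dvd X sDM nDM sMS.
have : #|M| %| \sum_(u in M) #|'Fix_(bact X)(phi @* (D <*> <[u]>))|.
  have := @burnside_dvd _ _ X (phi @* D)%G (phi @* M)%G.
  rewrite card_injm //= !morphimEdom big_imset /=; last exact/injmP.
  rewrite -morphimEdom => H; apply: dvdn_trans (H _ _ _) _ => //.
  - exact: morphimS.
  - exact: morphim_norms.
  rewrite (eq_bigr (fun u => #|'Fix_(bact X)(phi @* (D <*> <[u]>))|)) // => u Mu.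
  by rewrite morphimY ?cycle_subG // morphim_cycle.
rewrite (bigID (mem D)) [X in _ -> _ %| X -> _](bigID (mem D)) /=.
have cardD (B : {set X}) : (\sum_(u in M | u \in D) #|B| = #|D| * #|B|)%N.
  by rewrite -sum_nat_const; apply: eq_bigl => u; rewrite andb_idl // => /(subsetP sDM).
have joinD u : u \in D -> D <*> <[u]> = D by move=> Du; apply/joing_idPl; rewrite cycle_subG.
rewrite (eq_bigr (fun=> #|bfix X Q0 id|)) => [|u /andP[_ Du]]; last first.
  by rewrite joinD // phiD.
rewrite [X in _ -> _ %| X + _ -> _](eq_bigr (fun=> #|bfix X Q f|)) => [|u /andP[_ Du]]; last first.
  by rewrite joinD // ED.
rewrite !cardD; set R1 := (\sum_(u in M | _) _)%N; set R2 := (\sum_(u in M | _) _)%N.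
have -> : R1 = R2.
  apply: eq_bigr => u /andP[Mu nDu]; apply/esym/fixphi.
    by rewrite join_subG sDM cycle_subG.
  rewrite -cardQ -(card_graph Q f) -ED; apply: proper_card.
  rewrite properE joing_subl; apply: contra nDu => /subsetP; apply.
  by rewrite (subsetP (joing_subr D <[u]>)) ?cycle_id.
(* After multiplication by |D| and addition of the common rest [R2] to both terms, the difference is
   that of the two Burnside counts plus a multiple of |S x S|. *)
move=> dv0 dvQ; rewrite -(dvdn_pmul2l (cardG_gt0 D)) Lagrange //.
rewrite mulnBr -(subnDr R2) mulnDr addnAC; apply: dvdn_sub => //.
rewrite dvdn_addr //; apply/dvdn_mull/dvdn_mull; exact: cardSg.
Qed.

Definition centricb Q : bool := [forall R : {group gT}, fconj F Q R ==> ('C_S(R) \subset R)].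

Lemma centricP Q : reflect (centric F Q) (centricb Q).
Proof.
apply: (iffP forall_inP) => [cQ R f Ff|cQ R /fconjP[f Ff]]; last exact: cQ Ff.
by apply: cQ; apply/fconjP; exists f.
Qed.

Definition fn_conj Q R : bool := fconj F Q R &&
  [forall T : {group gT}, fconj F Q T ==> (#|'N_S(T)| <= #|'N_S(R)|)].

(** A choice depending only on the conjugacy class of Q, so that the numbers prescribed for
    non-centric subgroups are constant on classes. The default Q is met only when Q is not contained
    in S. *)
Definition fn_rep Q : {group gT} := odflt Q [pick R | fn_conj Q R].

Lemma fn_repP Q : Q \subset S ->
  fully_normalized F (fn_rep Q) /\ exists h, fiso F Q (fn_rep Q) h.
Proof.
rewrite /fn_rep => sQS; case: pickP => [R /andP[QR /forall_inP maxR]|noR] /=.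
  split; last exact/fconjP.
  by move=> T f Ff; apply: maxR; apply: fconj_trans QR _; apply/fconjP; exists f.
have [R [f [Ff nR]]] := fully_normalized_exists F sQS.
have QR : fconj F Q R by apply/fconjP; exists f.
have /negbT := noR R; rewrite /fn_conj QR /= => /forall_inPn[T QT].
have /fconjP[h Fh] := fconj_trans (fconj_sym QR) QT.
by rewrite (nR T h Fh).
Qed.

Lemma fn_rep_conj Q R : Q \subset S -> fconj F Q R -> fn_rep Q = fn_rep R.
Proof.
move=> sQS QR; have EQR T : fconj F Q T = fconj F R T.
  by apply/idP/idP; [apply: fconj_trans (fconj_sym QR)|apply: fconj_trans QR].
have EQR' : fn_conj Q =1 fn_conj R.
  move=> T; rewrite /fn_conj EQR; congr (_ && _); apply: eq_forallb => T'.
  by rewrite EQR.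
rewrite /fn_rep -(eq_pick EQR'); case: pickP => //= noR.
have [T [f [Ff nT]]] := fully_normalized_exists F sQS.
have QT : fconj F Q T by apply/fconjP; exists f.
have /negbT := noR T; rewrite /fn_conj QT /= => /forall_inPn[T' QT'].
have /fconjP[k Fk] := fconj_trans (fconj_sym QT) QT'.
by rewrite (nT T' k Fk).
Qed.

Lemma stabilize_step n (X : biset S) : stable_above n.+1 X ->
  exists Y : biset S, stable_above n Y.
Proof.
move=> saX; have [genX ltX stX cX] := saX.
(* Number of fixed points prescribed for Q of order n + 1: the minimum if Q is centric, and
   otherwise a value that [noncentric_level] admits for the whole class of Q. *)
pose c Q := if centricb Q then #|'Z(Q)|
  else (#|bfix X (fn_rep Q) id| + #|X| * #|setX S S|)%N.
have c_conj Q R h : fiso F Q R h -> c Q = c R.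
  move=> Fh; have [sQS _] := fiso_subS Fh; have QR : fconj F Q R by apply/fconjP; exists h.
  rewrite /c (fn_rep_conj sQS QR) (fiso_card_center Fh).
  suff -> : centricb Q = centricb R by [].
  apply/centricP/centricP => [cQ|cR]; first exact: centric_fiso cQ Fh.
  by have [k [Fk _ _]] := fiso_inv Fh; apply: centric_fiso cR Fk.
pose dom D := (snd @* D)%G.
have domE D Q f : D :=: graph Q f -> dom D = Q.
  move=> ED; apply: val_inj; rewrite /= morphimEsub ?subsetT // ED /graph -imset_comp.
  by rewrite -[RHS]imset_id.
(* [dom] recovers Q from its graph as the second projection; the value 0 elsewhere extends [t] to
   all subgroups while keeping it constant on conjugacy classes. *)
pose t D := if fusion_graph F D then c (dom D) else 0.
have tE D Q f : F Q S f -> D :=: graph Q f -> t D = c Q.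
  move=> Ff ED; rewrite /t ifT ?(domE _ _ _ ED) //.
  by apply/fusion_graphP; exists Q, f.
have tJ D g : g \in setX S S -> t (D :^ g)%G = t D.
  move=> Sg; rewrite /t.
  have -> : fusion_graph F (D :^ g) = fusion_graph F D.
    apply/idP/idP => [tDg|tD]; last exact: fusion_graphJ.
    by rewrite -(conjsgK g D); apply: fusion_graphJ; rewrite ?groupV.
  case: ifP => // /fusion_graphP[Q [f [Ff ED]]].
  have Sg2 : g.2 \in S by case: g Sg => g1 g2 /setXP[].
  rewrite (domE _ _ _ ED); apply/esym/(c_conj _ _ (conjg^~ g.2)).
  have -> : dom (D :^ g)%G = (Q :^ g.2)%G.
    apply: val_inj; rewrite /= morphimJ ?inE //=; congr (_ :^ _).
    by rewrite -(domE _ _ _ ED).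
  by apply: fiso_conj => //; apply: fmor_subl Ff.
have tX D : fusion_graph F D -> #|D| = n.+1 -> #|'Fix_(bact X)(D)| <= t D /\
    #|'N_(setX S S)(D) : D| %| t D - #|'Fix_(bact X)(D)|.
  case/fusion_graphP=> Q [f [Ff ED]]; rewrite (tE D Q f) // /c => cardD.
  have cardQ : #|Q| = n.+1 by rewrite -(card_graph Q f) -ED.
  have -> : 'Fix_(bact X)(D) = bfix X Q f by rewrite ED.
  case: ifP => [/centricP cQ|_]; first exact: centric_level saX cQ Ff cardQ ED.
  have [nQ0 [h Fh]] := fn_repP (fmor_subl Ff).
  exact: noncentric_level saX Ff cardQ ED nQ0 Fh.
have [Y [genY ltY fixY fixYX]] := add_orbits genX ltX tJ tX.
have sgS Q f : F Q S f -> graph Q f \subset setX S S.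
  by move=> Ff; rewrite graph_sub ?(fmor_subl Ff) ?(fmor_imgT Ff).
have fixYc Q f : F Q S f -> #|Q| = n.+1 -> #|bfix Y Q f| = c Q.
  move=> Ff cardQ; have [D ED tD] := fusion_graph_gen Ff.
  have cardD : #|D| = n.+1 by rewrite ED card_graph.
  by rewrite -(tE D Q f) // -(fixY D tD cardD) ED.
exists Y; split=> // [Q R f g h|Q f] ltQ.
  move=> Ff Fg Fh; have cardQR := fiso_card Fh.
  move: ltQ; rewrite leq_eqVlt => /predU1P[/esym EQ|ltQ].
    by rewrite !fixYc -?cardQR ?(c_conj _ _ _ Fh).
  by rewrite !fixYX ?sgS ?card_graph -?cardQR //; apply: stX Fh.
move=> cQ Ff; move: ltQ; rewrite leq_eqVlt => /predU1P[/esym EQ|ltQ].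
  by rewrite fixYc // /c ifT //; apply/centricP.
by rewrite fixYX ?sgS ?card_graph //; apply: cX.
Qed.

(** At level |S| the empty biset meets the invariant vacuously. Subtraction is truncated, so the
    induction is stationary once level 0 is reached. *)
Lemma stable_above_exists n : exists X : biset S, stable_above (#|S| - n) X.
Proof.
elim: n => [|n [X saX]].
  pose B (i : void) : biset S := match i with end.
  exists (bunion B); split; try by move=> [[]].
  - move=> Q R f g h; rewrite subn0 ltnNge => /negP ltQ /fmor_subl/subset_leq_card //.
  - move=> Q f; rewrite subn0 ltnNge => /negP ltQ _ /fmor_subl/subset_leq_card //.
have [lt_nS|le_Sn] := ltnP n #|S|.
  by apply: (@stabilize_step _ X); rewrite -subSn // subSS.
exists X; move: saX; have /eqP-> : #|S| - n == 0 by rewrite subn_eq0.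
by have /eqP-> : #|S| - n.+1 == 0 by rewrite subn_eq0 ltnW.
Qed.

Lemma Inn_Sylow : p.-Sylow(Aut_fusion F S) (Inn S).
Proof.
have nS : fully_normalized F S.
  move=> Q f Ff; have [_ sQS] := fiso_subS Ff.
  suff -> : Q = S by [].
  by apply/val_inj/eqP; rewrite eqEcard sQS (fiso_card Ff) /=.
have [_] := satF.1 S (subxx S) nS; rewrite /Aut_by /Inn.
by have /setIidPl-> := normG S.
Qed.

Lemma centric_self : centric F S.
Proof.
move=> Q f Ff; suff -> : Q = S by apply: subsetIl.
have [_ sQS] := fiso_subS Ff.
by apply/val_inj/eqP; rewrite eqEcard sQS (fiso_card Ff) /=.
Qed.

(** Level 0 of the invariant covers all subgroups; S itself is centric, which supplies the count
    that [char_criterion] asks for. *)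
Lemma char_biset_center : prime p -> exists X : biset S, char_biset p F X /\
  forall Q, Q \subset S -> centric F Q -> #|bfix X Q id| = #|'Z(Q)|.
Proof.
move=> pr_p; have [X] := stable_above_exists #|S|; rewrite subnn => -[genX _ stX cX].
have cX1 Q : Q \subset S -> centric F Q -> #|bfix X Q id| = #|'Z(Q)|.
  by move=> sQS cQ; apply: cX => //; apply: fmor_id.
exists X; split=> //; apply: char_criterion => //; first exact: Inn_Sylow.
  apply: (@semichar_intro _ _ _ _ (fun Q => #|bfix X Q id|)) => // [Q R f Ff|Q f Ff].
    have [sQS sRS] := fiso_subS Ff.
    by apply: (stX _ _ _ _ f); rewrite ?cardG_gt0 ?fmor_id.
  have sQS := fmor_subl Ff.
  by apply: (stX _ _ _ _ id); rewrite ?cardG_gt0 ?fmor_id ?fiso_id.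
by apply: cX1 => //; apply: centric_self.
Qed.

End Stabilization.

(** * Decomposition into indecomposables *)

Section Homs.

Variables (gT : finGroupType) (T : {group gT}).
Implicit Types (X Y Z : biset T) (Q R : {group gT}).

Lemma biset_iso_sym X Y : biset_iso X Y -> biset_iso Y X.
Proof.
case=> f [g fK gK] hf; exists g; first by exists f.
by move=> y u Tu; apply: (can_inj fK); rewrite hf // !gK.
Qed.

Lemma biset_iso_bij X Y (f : X -> Y) :
  injective f -> biset_hom f -> (forall y, exists x, f x = y) -> biset_iso X Y.
Proof.
move=> injf hf surf; exists f => //; apply: inj_card_bij => //.
rewrite -(card_codom injf); apply/subset_leq_card/subsetP=> y _.
by have [x <-] := surf y; apply: codom_f.
Qed.

Lemma hom_bfix X Y (f : X -> Y) (H : {set gT * gT}) x :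
  injective f -> biset_hom f -> H \subset setX T T ->
  (f x \in 'Fix_(bact Y)(H)) = (x \in 'Fix_(bact X)(H)).
Proof.
move=> injf hf sHT; apply/afixP/afixP => xH u Hu.
  by apply: injf; rewrite hf ?(subsetP sHT) // xH.
by rewrite -hf ?(subsetP sHT) // xH.
Qed.

Lemma card_hom_bfix X Y (f : X -> Y) (H : {set gT * gT}) :
  injective f -> biset_hom f -> H \subset setX T T ->
  #|'Fix_(bact Y)(H) :&: f @: setT| = #|'Fix_(bact X)(H)|.
Proof.
move=> injf hf sHT; rewrite -(card_imset 'Fix_(bact X)(H) injf); congr #|pred_of_set _|.
apply/setP=> y; apply/setIP/imsetP => [[yH /imsetP[x _ Ey]]|[x xH ->]].
  by exists x => //; rewrite -(hom_bfix _ injf hf sHT) -Ey.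
by rewrite hom_bfix ?imset_f.
Qed.

Lemma hom_acts X Y (f : X -> Y) : biset_hom f -> [acts setX T T, on f @: setT | bact Y].
Proof.
move=> hf; apply/subsetP=> u Tu; rewrite inE Tu inE; apply/subsetP=> _ /imsetP[x _ ->].
by rewrite inE -hf // imset_f.
Qed.

End Homs.

Section SubBisets.

Variables (gT : finGroupType) (T : {group gT}) (G : fusion_system T) (X : biset T).
Hypothesis genX : generated_biset G X.
Implicit Types (A B : {set X}) (Q R : {group gT}).

Definition sub_val A (nA : [acts setX T T, on A | bact X]) (x : sub_biset nA) : X := val x.

Lemma sub_val_inj A (nA : [acts setX T T, on A | bact X]) : injective (@sub_val A nA).
Proof. exact: val_inj. Qed.

Lemma sub_val_hom A (nA : [acts setX T T, on A | bact X]) : biset_hom (@sub_val A nA).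
Proof. by move=> x u Tu; rewrite /sub_val -(sub_biset_actE nA). Qed.

Lemma sub_val_im A (nA : [acts setX T T, on A | bact X]) : @sub_val A nA @: setT = A.
Proof.
apply/setP=> x; apply/imsetP/idP => [[y _ ->]|Ax]; first exact: valP.
by exists (exist (fun x => x \in A) x Ax).
Qed.

Lemma card_sub_bfix A (nA : [acts setX T T, on A | bact X]) Q f : G Q T f ->
  #|bfix (sub_biset nA) Q f| = #|bfix X Q f :&: A|.
Proof.
move=> Gf; rewrite -[in RHS](sub_val_im nA) (card_hom_bfix (@sub_val_inj A nA) (@sub_val_hom A nA)) //.
by rewrite graph_sub ?(fmor_subl Gf) ?(fmor_imgT Gf).
Qed.

Lemma hom_generated (Y : biset T) (f : Y -> X) : injective f -> biset_hom f -> generated_biset G Y.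
Proof.
move=> injf hf y; have [Q [g [Gg stg]]] := genX (f y); exists Q, g; split=> //.
rewrite -stg; apply/setP=> u; apply/bstabP/bstabP => -[Tu]; first by rewrite -hf // => ->.
by rewrite -hf // => /injf.
Qed.

Lemma sub_generated A (nA : [acts setX T T, on A | bact X]) : generated_biset G (sub_biset nA).
Proof. exact: hom_generated (@sub_val_inj A nA) (@sub_val_hom A nA). Qed.

(** Stated for subsets of X rather than for bisets mapped into it, so that complements can be
    formed. *)
Definition semichar_set A : Prop :=
  [/\ [acts setX T T, on A | bact X],
      forall Q f, G Q T f -> #|bfix X Q f :&: A| = #|bfix X Q id :&: A| &
      forall Q R f, fiso G Q R f -> #|bfix X Q id :&: A| = #|bfix X R id :&: A|].

Lemma semichar_set_sub A (nA : [acts setX T T, on A | bact X]) :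
  semichar_set A -> semichar_biset G (sub_biset nA).
Proof.
case=> _ cA1 cA2; apply: (@semichar_intro _ _ _ _ (fun Q => #|bfix X Q id :&: A|)).
- exact: sub_generated.
- exact: cA2.
- by move=> Q f Gf; rewrite card_sub_bfix // cA1.
Qed.

Lemma semichar_set_hom (Y : biset T) (f : Y -> X) : injective f -> biset_hom f ->
  stable_biset G Y -> semichar_set (f @: setT).
Proof.
move=> injf hf stY.
have cE Q g : G Q T g -> #|bfix X Q g :&: f @: setT| = #|bfix Y Q g|.
  by move=> Gg; rewrite card_hom_bfix // graph_sub ?(fmor_subl Gg) ?(fmor_imgT Gg).
split=> [|Q g Gg|Q R g Gg]; first exact: hom_acts.
  by rewrite !cE ?fmor_id ?(fmor_subl Gg) // (stable_fix stY Gg).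
have [sQT sRT] := fiso_subS Gg.
by rewrite !cE ?fmor_id // (stable_fix_fiso stY Gg).
Qed.

(** Fixed-point numbers subtract; this cancellation makes the complement of a semicharacteristic
    part a summand. *)
Lemma semichar_setD A B : semichar_set A -> semichar_set B -> B \subset A ->
  semichar_set (A :\: B).
Proof.
case=> nA cA1 cA2 [nB cB1 cB2] sBA.
have cE (E : {set X}) : #|E :&: (A :\: B)| = (#|E :&: A| - #|E :&: B|)%N.
  rewrite setIDA cardsD; congr (_ - #|pred_of_set _|)%N.
  by rewrite -setIA (setIidPr sBA).
split=> [|Q f Gf|Q R f Gf]; first exact: actsD.
  by rewrite !cE cA1 // cB1.
by rewrite !cE (cA2 _ _ _ Gf) (cB2 _ _ _ Gf).
Qed.

Lemma semichar_setT : stable_biset G X -> semichar_set setT.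
Proof.
move=> stX; split=> [|Q f Gf|Q R f Gf]; rewrite ?setIT.
- by apply/subsetP=> u Tu; rewrite inE Tu inE; apply/subsetP=> x _; rewrite !inE.
- exact: (stable_fix stX Gf).
- exact: (stable_fix_fiso stX Gf).
Qed.

(** The two parts of a splitting map onto disjoint semicharacteristic subsets that cover A; by
    minimality the first is empty or all of A, and in the latter case the second is empty. *)
Lemma indecomposable_sub A (nA : [acts setX T T, on A | bact X]) :
  semichar_set A -> A != set0 ->
  (forall B, semichar_set B -> B \subset A -> B = set0 \/ B = A) ->
  indecomposable G (sub_biset nA).
Proof.
move=> scA A0 minA; split; first exact: semichar_set_sub.
  rewrite -cardsT -(card_imset _ (@sub_val_inj A nA)) sub_val_im card_gt0 //.
move=> B scB /biset_iso_sym[f [g fK gK] hf].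
pose h b (y : B b) : X := sub_val (f (Tagged (fun b => B b : Type) y)).
have hh b : biset_hom (@h b).
  move=> y u Tu; rewrite /h -sub_val_hom //; congr (sub_val _).
  by rewrite -hf.
have injh b : injective (@h b).
  move=> y z /sub_val_inj/(can_inj fK)/eqP; rewrite -tag_eqE /tag_eq /= eqxx /=.
  by rewrite tagged_asE => /eqP.
have sh b : (@h b) @: setT \subset A.
  by apply/subsetP=> _ /imsetP[y _ ->]; apply: valP.
have [|h0|hA] := minA _ (semichar_set_hom (injh true) (hh true) (scB true).2).
- exact: sh.
- by left; rewrite -cardsT -(card_imset setT (injh true)) h0 cards0.
right; rewrite -cardsT -(card_imset setT (injh false)); apply/eqP; rewrite cards_eq0.
apply/eqP/setP=> x; rewrite in_set0; apply/negP=> /imsetP[y _ Ex].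
have : x \in A by rewrite Ex; apply: valP.
rewrite -hA => /imsetP[z _]; rewrite Ex => /sub_val_inj/(can_inj fK)/(congr1 tag) //.
Qed.

Lemma semichar_partition A : semichar_set A -> exists D : {set {set X}},
  [/\ partition D A, forall B, B \in D -> [acts setX T T, on B | bact X] &
      forall B (nB : [acts setX T T, on B | bact X]), B \in D -> indecomposable G (sub_biset nB)].
Proof.
have [n] := ubnP #|A|; elim: n A => // n IHn A; rewrite ltnS => leAn scA.
have [A0|nA0] := eqVneq A set0.
  exists set0; rewrite A0 partition_set0 eqxx; split=> // B; rewrite inE //.
(* [semichar_set] quantifies over arbitrary functions, so the existence of a proper part is decided
   classically. *)
have [[B [scB sBA B0 BA]]|noB] := classic (exists B,
    [/\ semichar_set B, B \subset A, B != set0 & B != A]).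
  have cAB : #|A :\: B| + #|B| = #|A| by rewrite addnC -(cardsID B A) (setIidPr sBA).
  have ltB : #|B| < n.
    by apply: leq_trans (proper_card _) leAn; rewrite properEneq BA.
  have ltAB : #|A :\: B| < n.
    by apply: leq_trans leAn; rewrite -cAB -[X in X < _]addn0 ltn_add2l card_gt0.
  have [D1 [pD1 nD1 iD1]] := IHn _ ltB scB.
  have [D2 [pD2 nD2 iD2]] := IHn _ ltAB (semichar_setD scA scB sBA).
  exists (D1 :|: D2); split.
  - case/and3P: pD1 => /eqP cov1 tr1 n01; case/and3P: pD2 => /eqP cov2 tr2 n02.
    apply/and3P; split; last by rewrite inE negb_or n01.
      by rewrite /cover bigcup_setU -!/(cover _) cov1 cov2 -{1}(setIidPr sBA) setID.
    apply: trivIsetU => //; rewrite cov1 cov2; apply/setDidPl.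
    by apply/setP=> x; rewrite !inE; case: (x \in B); rewrite ?andbF.
  - by move=> C /setUP[/nD1|/nD2].
  - by move=> C nC /setUP[/iD1|/iD2]; apply.
exists [set A]; split=> [|B /set1P->|B nB /set1P EB].
- by apply/and3P; rewrite /cover big_set1 eqxx trivIset1 inE eq_sym.
- by case: scA.
move: nB; rewrite EB => nA; apply: indecomposable_sub => // B' scB' sB'A.
have [->|B'0] := eqVneq B' set0; first by left.
have [->|B'A] := eqVneq B' A; first by right.
by case: noB; exists B'.
Qed.

Lemma bunion_partition (D : {set {set X}})
    (nD : forall B, B \in D -> [acts setX T T, on B | bact X]) :
  partition D setT ->
  biset_iso X (bunion (fun B : {B : {set X} | B \in D} => sub_biset (nD (val B) (valP B)))).
Proof.
case/and3P=> /eqP covD /trivIsetP trD _; apply: biset_iso_sym.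
set U := bunion _; pose g (u : U) : X := sub_val (tagged u).
apply: (@biset_iso_bij _ _ U X g).
- move=> u v; rewrite /g => guv.
  have Etag : tag u = tag v.
    have uu : g u \in val (tag u) by apply: (valP (tagged u)).
    have uv : g u \in val (tag v) by rewrite /g guv; apply: (valP (tagged v)).
    apply/val_inj/eqP; apply: contraTT isT => /(trD _ _ (valP _) (valP _))/pred0P/(_ (g u)).
    by rewrite /= uu uv.
  case: u v guv Etag => i x [j y] /= guv Eij; case: j / Eij y guv => y /sub_val_inj -> //.
- by move=> u w Tw; rewrite /g -sub_val_hom.
- move=> x; have : x \in cover D by rewrite covD.
  case/bigcupP=> B DB Bx.
  pose i : {B : {set X} | B \in D} := exist (fun B : {set X} => B \in D) B DB.
  pose y : sub_biset (nD (val i) (valP i)) := exist (fun x : X => x \in B) x Bx.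
  by exists (Tagged (fun i : {B : {set X} | B \in D} => sub_biset (nD (val i) (valP i)) : Type) y).
Qed.

(** Otherwise A and its complement would be a proper splitting of X. *)
Lemma indecomposable_semichar_set A : indecomposable G X -> semichar_set A ->
  A != set0 -> A = setT.
Proof.
case=> [[_ stX] _ indX] scA A0.
have scCA : semichar_set (~: A).
  by rewrite -setTD; apply: semichar_setD; rewrite ?subsetT //; apply: semichar_setT.
pose C (b : bool) := if b then A else ~: A.
have nC b : [acts setX T T, on C b | bact X] by case: b; [case: scA|case: scCA].
have scC b : semichar_biset G (sub_biset (nC b)).
  by apply: semichar_set_sub; case: b.
have cardC b : #|sub_biset (nC b)| = #|C b|.
  by rewrite -cardsT -(card_imset _ (@sub_val_inj _ (nC b))) sub_val_im.
case: (indX (fun b => sub_biset (nC b)) scC); last 2 first.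
- by rewrite cardC => /eqP; rewrite cards_eq0 (negPf A0).
- by rewrite cardC => /eqP; rewrite cards_eq0 => /eqP; rewrite /C => CA0; rewrite -[A]setCK CA0 setC0.
apply: biset_iso_sym; set U := bunion _; pose g (u : U) : X := sub_val (tagged u).
have tagC (u : U) : tag u = (g u \in A).
  by case: u => -[] x; rewrite /g /=; have := valP x; rewrite /C /sub_val /= ?inE //; move/negbTE.
apply: (@biset_iso_bij _ _ U X g).
- move=> u v guv; have : tag u = tag v by rewrite !tagC guv.
  case: u v guv => b x [c y] guv /= Ebc; case: c / Ebc y guv => y guv.
  by have -> : x = y by apply: sub_val_inj.
- by move=> u w Tw; rewrite /g -sub_val_hom.
move=> x; have Cx : x \in C (x \in A) by rewrite /C; case: ifP => //; rewrite inE => ->.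
pose y : sub_biset (nC (x \in A)) := exist (fun z : X => z \in C (x \in A)) x Cx.
by exists (Tagged (fun b => sub_biset (nC b) : Type) y).
Qed.

End SubBisets.

(** * The summand isomorphic to the minimal characteristic biset *)

Section Uniqueness.

Variables (gT : finGroupType) (T : {group gT}) (G : fusion_system T) (X : biset T).
Hypothesis genX : generated_biset G X.
Implicit Types (A B : {set X}) (Q R : {group gT}).

(* By the hypothesis on its cardinality, X^T is a single left orbit, so it
   lies in one summand; this summand is characteristic, hence contains L. *)
Lemma contains_one_criterion p (L : biset T) : prime p -> p.-group T ->
  p.-Sylow(Aut_fusion G T) (Inn T) -> stable_biset G X ->
  #|bfix X T id| = #|'Z(T)| ->
  minimal_char_biset p G L -> biset_embeds L X -> contains_precisely_one G L X.
Proof.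
move=> pr_p pT sylT stX fixX [chL minL] [e inje he].
have [D [pD nD iD]] := semichar_partition genX (semichar_setT stX).
pose B (i : {A : {set X} | A \in D}) := sub_biset (nD (val i) (valP i)).
have sgT : graph T id \subset setX T T by rewrite graph_sub ?imset_id.
have sZT : 'Z(T) \subset T by apply: center_sub.
have trX x y : x \in bfix X T id -> y \in bfix X T id ->
    exists2 z, z \in 'Z(T) & y = bact X x (z, 1).
  apply: left_orbit_transitive; rewrite ?imset_id ?fixX //.
  by move=> z /setIP[_ cz] a Ta; apply/commute_sym/(centP cz).
have /card_gt0P[y0 y0T] := char_fix_card pr_p pT chL.
have x0T : e y0 \in bfix X T id by rewrite hom_bfix.
have covD : cover D = setT by case/and3P: pD => /eqP.
have /bigcupP[A DA Ax0] : e y0 \in cover D by rewrite covD.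
have sfixA : bfix X T id \subset A.
  apply/subsetP=> y /(trX _ _ x0T)[z /setIP[Tz _] ->].
  by rewrite (acts_act (nD A DA)) // inE /= Tz group1.
exists {A : {set X} | A \in D}, B; split.
- by move=> i; apply: iD; apply: valP.
- exact: bunion_partition.
exists (exist (fun A : {set X} => A \in D) A DA); split.
  set i := exist _ _ _.
  have indB : indecomposable G (B i) := iD _ _ (valP i).
  have [[genB stB] _ _] := indB.
  have chB : char_biset p G (B i).
    apply: char_criterion => //.
    by rewrite (card_sub_bfix _ (fmor_id G (subxx T) (subxx T))) (setIidPl sfixA).
  have [f injf hf] := minL _ chB.
  apply/biset_iso_sym/(biset_iso_bij injf hf) => y.
  (* The image of L in this summand is nonempty and semicharacteristic, so indecomposability makes
     it everything. *)
  have fT : f @: setT = setT.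
    apply: (indecomposable_semichar_set genB indB).
      by apply: semichar_set_hom => //; case: chL => -[].
    by apply/set0Pn; exists (f y0); apply: imset_f.
  by have : y \in f @: setT by [rewrite fT]; case/imsetP=> x _ ->; exists x.
(* Any summand isomorphic to L has a point fixed by the diagonal of T, and all of these lie in A. *)
move=> [C DC] [f [g fK gK] hf]; apply: val_inj => /=.
have hg : biset_hom g by move=> y u Tu; apply: (can_inj fK); rewrite hf // !gK.
have : sub_val (g y0) \in bfix X T id.
  by rewrite (hom_bfix _ (@sub_val_inj _ _ _ _ _) (@sub_val_hom _ _ _ _ _)) //
    (hom_bfix _ (can_inj gK) hg).
move/(subsetP sfixA) => Agy; have Cgy : sub_val (g y0) \in C by apply: valP.
case/and3P: pD => _ /trivIsetP trD _; apply/eqP; apply: contraTT isT => nAC.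
by have /pred0P/(_ (sub_val (g y0))) := trD _ _ DA DC nAC; rewrite /= Agy Cgy.
Qed.

End Uniqueness.

(** * The normalizer fusion system *)

(** The embedding into the biset of [char_biset_center] bounds the number from above. From below, a
    point fixed by the diagonal of S has |Z(Q)| left translates fixed by that of Q. *)
Lemma minimal_char_center (p : nat) (gT : finGroupType) (S : {group gT})
    (F : fusion_system S) (X : biset S) (Q : {group gT}) :
  prime p -> p.-group S -> saturated p F -> minimal_char_biset p F X ->
  Q \subset S -> centric F Q -> #|bfix X Q id| = #|'Z(Q)|.
Proof.
move=> pr_p pS satF [chX minX] sQS cQ.
have [Y [chY fixY]] := char_biset_center pS satF pr_p.
have [e inje he] := minX Y chY.
have sgS (R : {group gT}) : R \subset S -> graph R id \subset setX S S.
  by move=> sRS; rewrite graph_sub ?imset_id.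
apply/eqP; rewrite eqn_leq; apply/andP; split.
  rewrite -(fixY Q) // -(card_hom_bfix inje he) ?sgS //.
  by apply/subset_leq_card/subsetIl.
have /card_gt0P[x xS] := char_fix_card pr_p pS chX.
have xQ : x \in bfix X Q id.
  by apply/bfixP=> a Qa; apply: (bfixP _ _ _ xS); apply: (subsetP sQS).
have sZS : 'Z(Q) \subset S := subset_trans (center_sub Q) sQS.
rewrite -(card_left_orbit sZS x); apply: subset_leq_card.
apply: left_orbit_sub => //; first by rewrite imset_id.
by move=> z /setIP[_ cz] a Qa; apply/commute_sym/(centP cz).
Qed.

Section NormalizerFusion.

Variables (gT : finGroupType) (S : {group gT}) (F : fusion_system S).
Variables (P : {group gT}) (K : {group {perm gT}}).
Hypotheses (sPS : P \subset S) (sKA : K \subset Aut P).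
Implicit Types (Q R A : {group gT}) (f g h : gT -> gT).

Local Notation N := (autnorm_group S P K).
Local Notation NF := (autnorm_fusion F K sPS).

Lemma mem_autnorm Q (L : {set {perm gT}}) n :
  (n \in autnorm S Q L) = [&& n \in S, n \in 'N(Q) & conj_aut Q n \in L].
Proof. by rewrite !inE. Qed.

Lemma autnorm_subS : N \subset S.
Proof. exact: subsetIl. Qed.

Lemma autnorm_norm : N \subset 'N(P).
Proof. by apply/subsetP=> n /autnormP[]. Qed.

Lemma cent_sub_autnorm Q (L : {set {perm gT}}) : 1 \in L -> 'C_S(Q) \subset autnorm S Q L.
Proof.
move=> L1; apply/subsetP=> c /setIP[Sc Cc]; rewrite mem_autnorm Sc (subsetP (cent_sub Q)) //=.
have : c \in 'ker (conj_aut Q) by rewrite ker_conj_aut.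
by move/mker=> ->.
Qed.

Lemma autnorm_map A Q f a : F A S f -> P \subset A -> f @: P = Q ->
  a \in A -> a \in N -> f a \in autnorm S Q (autconj P Q f K).
Proof.
move=> Ff sPA fP Aa /autnormP[Sa nPa Ka].
have fJ x : x \in P -> f x ^ f a = f (x ^ a).
  by move=> Px; rewrite (fmorJ Ff) // (subsetP sPA).
have nQfa : f a \in 'N(Q).
  rewrite inE -fP; apply/subsetP=> _ /imsetP[_ /imsetP[x Px ->] ->].
  by rewrite fJ // imset_f ?memJ_norm.
rewrite mem_autnorm (fmor_in Ff) //= nQfa; apply/setIdP; split.
  by rewrite (subsetP (Aut_conj_aut Q 'N(Q))) ?mem_morphim.
apply/exists_inP; exists (conj_aut P a) => //; apply/forall_inP=> x Px.
by rewrite !norm_conj_autE ?fJ // -fP imset_f.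
Qed.

Lemma Aut_mem k x : k \in K -> x \in P -> k x \in P.
Proof. by move=> /(subsetP sKA)/Aut_closed; apply. Qed.

Lemma autnorm_map_self A f k a : F A S f -> P \subset A -> f @: P = P ->
  k \in K -> {in P, f =1 k} -> a \in A -> a \in N -> f a \in N.
Proof.
move=> Ff sPA fP Kk fk Aa Na; have := autnorm_map Ff sPA fP Aa Na.
rewrite mem_autnorm => /and3P[Sfa nfa /setIdP[Afa /exists_inP[k' Kk' /forall_inP fak']]].
apply/autnormP; split=> //.
suff -> : conj_aut P (f a) = k^-1 * k' * k by rewrite !groupM ?groupV.
apply: (@eq_Aut _ P) => // [|x Px].
  by rewrite (subsetP sKA) // !groupM ?groupV.
have Px' : k^-1 x \in P by apply: Aut_mem; rewrite ?groupV.
by rewrite !permM -{1}(permKV k x) -fk // (eqP (fak' _ Px')) fk // Aut_mem.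
Qed.

(** f carries N injectively into the corresponding normalizer of Q, which by full K-normalization is
    not larger. *)
Lemma autnorm_full A Q f : fully_autnormalized F P K -> F A S f -> P \subset A ->
  N \subset A -> f @: P = Q -> f @: N = autnorm S Q (autconj P Q f K).
Proof.
move=> fullP Ff sPA sNA fP; apply/eqP; rewrite eqEcard; apply/andP; split.
  apply/subsetP=> _ /imsetP[a Na ->]; apply: (autnorm_map Ff) => //.
  exact: (subsetP sNA).
rewrite card_in_imset; first exact: fullP (fmor_resS Ff sPA) fP.
by move=> x y Nx Ny; apply: (fmor_inj Ff); apply: (subsetP sNA).
Qed.

Lemma join_autnorm_sub R : R \subset N -> P <*> R \subset S.
Proof. by move=> sRN; rewrite join_subG sPS (subset_trans sRN autnorm_subS). Qed.

Lemma join_autnormE R : R \subset N -> P <*> R = P * R.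
Proof. by move=> sRN; rewrite norm_joinEr // (subset_trans sRN autnorm_norm). Qed.

Lemma autconj1 Q f : f @: P = Q -> 1 \in autconj P Q f K.
Proof.
move=> fP; apply/setIdP; split; first exact: group1.
apply/exists_inP; exists 1; first exact: group1.
by apply/forall_inP=> x Px; rewrite !perm1.
Qed.

(** For the image Q1 of P, C_S(Q) <= C_S(Q1) lies in the normalizer of Q1 relative to the
    transported K; by [autnorm_full] this normalizer is f(N), a part of Q. *)
Lemma join_autnorm_centric : fully_autnormalized F P K -> centric F (P <*> N)%G.
Proof.
move=> fullP Q f Ff; have FfQ := fiso_mor Ff.
have [sPPN sNPN] := joing_sub (erefl (P <*> N)).
have [Q1 fP] := fmor_img FfQ sPPN.
have Ff' := fmor_resS FfQ (subxx _).
have fN := autnorm_full fullP Ff' sPPN sNPN fP.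
have sQ1Q : Q1 \subset Q by rewrite -fP -(fiso_img Ff) imsetS.
apply: (@subset_trans _ _ 'C_S(Q1)); first by rewrite setIS ?centS.
have sCN : 'C_S(Q1) \subset autnorm S Q1 (autconj P Q1 f K).
  exact: cent_sub_autnorm (autconj1 fP).
apply: subset_trans sCN _.
by rewrite -fN -(fiso_img Ff) imsetS.
Qed.

(* A p-element of Aut(N) extends to a p-element of Aut_F(PN), which becomes
   conjugation by some s on a conjugate of PN; full K-normalization forces s
   to lie in the image of N. *)
Lemma autnorm_Sylow (p : nat) : p.-group S -> saturated p F ->
  fully_autnormalized F P K -> p.-Sylow(Aut_fusion NF N) (Inn N).
Proof.
move=> pS satF fullP.
pose AN := Group (Aut_fusion_group_set NF (subxx N)).
have pN : p.-group N := pgroupS autnorm_subS pS.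
have pI : p.-group (conj_aut N @* N) by apply: morphim_pgroup.
have sIA : conj_aut N @* N \subset AN.
  have := Aut_by_sub NF (subxx N); rewrite /Aut_by.
  by have /setIidPl-> := normG N.
(* It suffices that all p-elements are inner: a Sylow subgroup is then contained in the p-group
   Inn(N). *)
have elI a : a \in AN -> p.-elt a -> a \in Inn N.
  move=> ANa pa; have [Aa /autnorm_morP[_ _ Fa [g [Fg gP [k Kk gk] ga]]]] := Aut_fusionP _ _ _ ANa.
  have [sPJ sNJ] := joing_sub (erefl (P <*> N)).
  have [b Fb gb] := fmor_aut Fg; have [Ab _] := Aut_fusionP _ _ _ Fb.
  have aN x : x \in N -> a x \in N by move=> Nx; exact: (Aut_closed Aa Nx).
  have bXN i : {in N, b ^+ i =1 a ^+ i}.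
    move=> x Nx; elim: i => [|i IHi]; first by rewrite !expg0.
    rewrite !expgSr !permM IHi -gb ?ga //; last by rewrite (subsetP sNJ) // Aut_closed ?groupX.
    by rewrite Aut_closed ?groupX.
  have bXP i : {in P, b ^+ i =1 k ^+ i}.
    move=> x Px; elim: i => [|i IHi]; first by rewrite !expg0.
    rewrite !expgSr !permM IHi -gb ?gk //; last by rewrite (subsetP sPJ) // Aut_mem ?groupX.
    by rewrite Aut_mem ?groupX.
  (* e is 1 modulo the p-part of the order of b and 0 modulo the p'-part, so b^e is the p-part of b;
     a^e = a since the order of a is a power of p dividing that of b. *)
  pose e := chinese #[b]`_p #[b]`_p^' 1 0.
  have Eb : b.`_p = b ^+ e by [].
  have ae : a ^+ e = a.
    have dv : #[a] %| #[b].
      rewrite order_dvdn; apply/eqP; apply: (@eq_Aut _ N); rewrite ?groupX ?group1 // => x Nx.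
      by rewrite -bXN // expg_order.
    have dvp : #[a] %| #[b]`_p.
      rewrite -(part_pnat_id pa); apply: partn_dvd dv; exact: order_gt0.
    apply/eqP; rewrite -{2}(expg1 a) eq_expg_mod_order.
    have := chinese_modl (coprime_partC p #[b] #[b]) 1 0; rewrite -/e => Ee.
    by rewrite -(modn_dvdm e dvp) Ee modn_dvdm.
  have FJb : b ^+ e \in Aut_fusion F (P <*> N)%G.
    by rewrite -[Aut_fusion _ _]/(gval
      (Group (Aut_fusion_group_set F (join_autnorm_sub (subxx N))))) groupX.
  have pbe : p.-elt (b ^+ e) by rewrite -Eb p_elt_constt.
  have [T [f [s [Ff Ns fs]]]] := realize_paut satF (join_autnorm_sub (subxx N)) FJb pbe.
  have FfT := fiso_mor Ff; have Ff' := fmor_resS FfT (subxx _).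
  have [Q fP] := fmor_img FfT sPJ.
  have : s \in autnorm S Q (autconj P Q f K).
    have fsP x : x \in P -> f x ^ s = f ((k ^+ e) x).
      by move=> Px; rewrite -bXP // fs // (subsetP sPJ).
    have nQs : s \in 'N(Q).
      rewrite inE -fP; apply/subsetP=> _ /imsetP[_ /imsetP[x Px ->] ->].
      by rewrite fsP // imset_f // Aut_mem ?groupX.
    rewrite mem_autnorm nQs; case/setIP: (Ns) => -> _ /=; apply/setIdP; split.
      by rewrite (subsetP (Aut_conj_aut Q 'N(Q))) ?mem_morphim.
    apply/exists_inP; exists (k ^+ e); first exact: groupX.
    apply/forall_inP=> x Px; rewrite norm_conj_autE ?fsP // -fP imset_f //.
  rewrite -(autnorm_full fullP Ff' sPJ sNJ fP) => /imsetP[n Nn Es].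
  apply/morphimP; exists n; rewrite ?(subsetP (normG N)) //.
  apply: (@eq_Aut _ N) => // [|x Nx].
    by rewrite (subsetP (Aut_conj_aut N 'N(N))) // mem_morphim // (subsetP (normG N)).
  rewrite norm_conj_autE ?(subsetP (normG N)) //.
  apply: (fmor_inj Ff'); rewrite ?(subsetP sNJ) ?aN ?groupJ //.
  by rewrite -[in LHS]ae -bXN // fs ?(subsetP sNJ) // Es -(fmorJ Ff') ?(subsetP sNJ).
have [H sylH] := Sylow_exists p AN.
have sHI : H \subset conj_aut N @* N.
  apply/subsetP=> a Ha; apply: elI; first exact: subsetP (pHall_sub sylH) _ Ha.
  exact: mem_p_elt (pHall_pgroup sylH) Ha.
by rewrite /Inn (sub_pHall sylH pI sHI sIA).
Qed.

End NormalizerFusion.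

(** * The normalizer biset *)

Section NormalizerBiset.

Variables (gT : finGroupType) (S : {group gT}) (F : fusion_system S) (W : biset S).
Variables (P : {group gT}) (K : {group {perm gT}}).
Hypotheses (sPS : P \subset S) (sKA : K \subset Aut P).
Hypotheses (genW : generated_biset F W) (stW : stable_biset F W).
Implicit Types (Q R A : {group gT}) (f g h : gT -> gT).

Local Notation N := (autnorm_group S P K).
Local Notation NF := (autnorm_fusion F K sPS).
Local Notation X := (autnorm_biset W P K).

Lemma autnorm_bactE (x : X) u : u \in setX N N -> val (bact X x u) = bact W (val x) u.
Proof. exact: sub_biset_actE. Qed.

Lemma autnorm_bfixE R f (x : X) : R \subset N -> f @: R \subset N ->
  (x \in bfix X R f) = (val x \in bfix W R f).
Proof.
move=> sRN sfN.
have Nfa a : a \in R -> (f a, a) \in setX N N.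
  by move=> Ra; apply/setXP; rewrite (subsetP sfN) ?imset_f // (subsetP sRN).
apply/bfixP/bfixP => xR a Ra; first by rewrite -autnorm_bactE ?Nfa ?xR.
by apply: val_inj; rewrite autnorm_bactE ?Nfa ?xR.
Qed.

(** The function in the definition of [autnorm_pts] is arbitrary; as the graph determines its
    values, it agrees with the morphism supplied by [genW]. *)
Lemma autnorm_ptsE (w : W) : w \in autnorm_pts W P K -> exists Q f,
  [/\ bstab w = graph Q f, F Q S f, P \subset Q, f @: P = P &
      exists2 k, k \in K & {in P, f =1 k}].
Proof.
case/autnorm_ptsP=> Q0 [f0 [E0 sPQ0 /restr_inP[f0P [k Kk f0k]]]].
have [Q [f [Ff E]]] := genW w; exists Q, f.
have /graph_subP[sQ0Q f0f] : graph Q0 f0 \subset graph Q f by rewrite -E0 E.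
have ff0 : {in P, f =1 f0} by move=> x Px; rewrite f0f // (subsetP sPQ0).
split=> //; first exact: subset_trans sQ0Q.
  by rewrite -{2}f0P; apply: eq_in_imset.
by exists k => // x Px; rewrite ff0 ?f0k.
Qed.

Lemma autnorm_pts_fix (w : W) R f : F (P <*> R)%G S f -> f @: P = P ->
  (exists2 k, k \in K & {in P, f =1 k}) -> w \in bfix W (P <*> R)%G f ->
  w \in autnorm_pts W P K.
Proof.
move=> Ff fP fK; rewrite fix_bstab; last first.
  by rewrite graph_sub ?(fmor_subl Ff) ?(fmor_imgT Ff).
have [Q [g [Fg Ew]]] := genW w; rewrite Ew => /graph_subP[sJQ fg].
have sPJ : P \subset P <*> R := joing_subl P R.
have gf : {in P, g =1 f} by move=> x Px; rewrite fg // (subsetP sPJ).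
apply/autnorm_ptsP; exists Q, g; split=> //; first exact: subset_trans sPJ sJQ.
apply/restr_inP; split; first by rewrite -{2}fP; apply: eq_in_imset.
by have [k Kk fk] := fK; exists k => // x Px; rewrite gf ?fk.
Qed.

(** The stabilizer in N x N is the graph of f restricted to R. As f restricts to K on P, it maps R
    into N, and f on PR is the extension required of a morphism of N_F^K(P). *)
Lemma autnorm_bstab (x : X) : exists (R Q : {group gT}) f,
  [/\ bstab x = graph R f, NF R N f, R :=: Q :&: N, P \subset Q & F Q S f].
Proof.
have [Q [f [Ew Ff sPQ fP [k Kk fk]]]] := autnorm_ptsE (valP x).
have sNS := autnorm_subS S P K; have sQS := fmor_subl Ff.
pose R := (Q :&: N)%G; exists R, Q, f.
have fN : f @: R \subset N.
  apply/subsetP=> _ /imsetP[a /setIP[Qa Na] ->].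
  exact: (autnorm_map_self sKA Ff sPQ fP Kk fk).
have sPRQ : P <*> R \subset Q by rewrite join_subG sPQ subsetIl.
have sPNS : P <*> N \subset S by rewrite join_subG sPS.
split=> //.
  apply/setP=> -[b a]; apply/bstabP/graphP => [[/setXP[Nb Na] /(congr1 val)]|].
    rewrite autnorm_bactE; last by apply/setXP.
    move=> xba; have : (b, a) \in bstab (val x : W).
      by apply/bstabP; split=> //; apply/setXP; rewrite !(subsetP sNS).
    by rewrite Ew => /graphP[Qa ->]; split=> //; apply/setIP.
  case=> Ra ->; have /setIP[Qa Na] := Ra.
  have Nfa : f a \in N by rewrite (subsetP fN) ?imset_f.
  have NN : (f a, a) \in setX N N by apply/setXP.
  split=> //; apply: val_inj; rewrite autnorm_bactE //.
  by have /bstabP[] : (f a, a) \in bstab (val x : W) by rewrite Ew; apply/graphP.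
apply/autnorm_morP; split; rewrite ?subsetIr //.
  by apply: (fmor_res Ff) => //; apply: subsetIl.
exists f; split=> //; last by exists k.
apply: (fmor_res Ff) => //.
apply/subsetP=> _ /imsetP[c Jc ->]; move: Jc; rewrite /= (@join_autnormE _ S P K) ?subsetIr //.
case/mulsgP=> a b Pa Rb ->; have Qb : b \in Q by case/setIP: Rb.
have Qa := subsetP sPQ a Pa.
rewrite (fmorM Ff Qa Qb); apply: (@groupM _ (P <*> N)%G).
  by apply: (subsetP (joing_subl P N)); rewrite -fP imset_f.
by rewrite (subsetP (joing_subr P N)) // (subsetP fN) ?imset_f.
Qed.

Lemma autnorm_generated : generated_biset NF X.
Proof. by move=> x; have [R [Q [f [Ex NFf _ _ _]]]] := autnorm_bstab x; exists R, f. Qed.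

(* Composing these automorphisms with one extension of f : R -> N to PR that
   restricts to K on P gives all such extensions. *)
Definition ext_auts R : {set {perm gT}} :=
  [set u in Aut_fusion F (P <*> R)%G | restr_in P K u && [forall x in R, u x == x]].

Lemma ext_autsP R u : reflect
  [/\ u \in Aut_fusion F (P <*> R)%G, u @: P = P, exists2 k, k \in K & {in P, u =1 k} &
      {in R, forall x, u x = x}] (u \in ext_auts R).
Proof.
apply: (iffP setIdP) => [[Fu /andP[/restr_inP[uP uK] /forall_inP uR]]|[Fu uP uK uR]].
  by split=> // x /uR/eqP.
split=> //; apply/andP; split; first exact/restr_inP.
by apply/forall_inP=> x /uR->.
Qed.

(** The stabilizer of x is the graph of some h that extends f and restricts to K on P. As g and h
    both map P onto P and agree on R, h maps PR into g(PR), and u = g^-1 h. *)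
Lemma autnorm_fix_ext R f g (x : X) : NF R N f ->
  F (P <*> R)%G (P <*> N)%G g -> g @: P = P -> (exists2 k, k \in K & {in P, g =1 k}) ->
  {in R, g =1 f} -> x \in bfix X R f ->
  exists2 u, u \in ext_auts R & val x \in bfix W (P <*> R)%G (g \o u).
Proof.
move=> NFf Fg gP [k Kk gk] gf; have /autnorm_morP[sRN _ Ff _] := NFf.
have [_ _ sfN] := fmor_injhom Ff; rewrite autnorm_bfixE // => xR.
have [Q [h [Ew Fh sPQ hP [l Kl hl]]]] := autnorm_ptsE (valP x).
have [sPJ sRJ] := joing_sub (erefl (P <*> R)).
have sNS := autnorm_subS S P K.
have /graph_subP[sRQ fh] : graph R f \subset graph Q h.
  rewrite -Ew -fix_bstab // graph_sub ?(subset_trans sRN) //.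
  exact: subset_trans sfN sNS.
have sJQ : P <*> R \subset Q by rewrite join_subG sPQ.
have [B gJ] := fmor_img Fg (subxx _).
have Fg' := fiso_intro Fg gJ; have [g' [Fg'B gK g'K]] := fiso_inv Fg'.
have hB y : y \in P <*> R -> h y \in B.
  rewrite (join_autnormE sRN) => /mulsgP[a b Pa Rb ->].
  rewrite (fmorM Fh (subsetP sPQ a Pa) (subsetP sRQ b Rb)) groupM //.
    have : h a \in P by rewrite -hP imset_f.
    rewrite -{1}gP => /imsetP[c Pc ->]; rewrite -gJ imset_f //.
    exact: (subsetP sPJ).
  by rewrite -fh // -gf // -gJ imset_f // (subsetP sRJ).
have FhB : F (P <*> R)%G B h.
  apply: (fmor_res Fh) => //; first by case: (fiso_subS Fg').
  by apply/subsetP=> _ /imsetP[y Jy ->]; apply: hB.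
have [u Fu gu] := fmor_aut (fmor_comp FhB (fiso_mor Fg'B)).
have guh y : y \in P <*> R -> g (u y) = h y by move=> Jy; rewrite -gu //= g'K // hB.
have uP : {in P, u =1 l * k^-1}.
  move=> y Py; have Jy := subsetP sPJ y Py; rewrite -gu //= permM.
  have Ply : l y \in P by apply: (Aut_mem sKA).
  have Pk : k^-1 (l y) \in P by apply: (Aut_mem sKA); rewrite ?groupV.
  apply: (fmor_inj Fg); first exact: (fmor_in (fiso_mor Fg'B) (hB y Jy)).
    exact: (subsetP sPJ).
  by rewrite g'K ?hB // hl // gk // permKV.
exists u.
  apply/ext_autsP; split=> //; last 2 first.
  - by exists (l * k^-1); rewrite ?groupM ?groupV.
  - move=> y Ry; have Jy := subsetP sRJ y Ry.
    by rewrite -gu //= -fh // -gf // gK.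
  have Klk : l * k^-1 \in K by rewrite groupM ?groupV.
  rewrite -[RHS](Aut_fusion_img (subsetP sKA _ Klk)).
  exact: eq_in_imset.
apply/bfixP=> y Jy; rewrite /= guh //.
by have /bstabP[] : (h y, y) \in bstab (val x : W) by rewrite Ew; apply/graphP; rewrite (subsetP sJQ).
Qed.

Lemma autnorm_card_fix R f : NF R N f ->
  #|bfix X R f| = (#|ext_auts R| * #|bfix W (P <*> R)%G id|)%N.
Proof.
move=> NFf; have /autnorm_morP[sRN _ Ff [g [Fg gP [k Kk gk] gf]]] := NFf.
have [_ _ sfN] := fmor_injhom Ff.
have [sPJ sRJ] := joing_sub (erefl (P <*> R)).
have sJNS : P <*> N \subset S := join_autnorm_sub sPS (subxx N).
have Fgu u : u \in ext_auts R -> F (P <*> R)%G S (g \o u).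
  case/ext_autsP=> /Aut_fusionP[_ Fu] _ _ _.
  exact: fmor_resS (fmor_comp Fu Fg) (subxx _).
have guP u : u \in ext_auts R -> (g \o u) @: P = P.
  by case/ext_autsP=> _ uP _ _; rewrite imset_comp uP.
have guK u : u \in ext_auts R -> exists2 l, l \in K & {in P, g \o u =1 l}.
  case/ext_autsP=> _ _ [l Kl ul] _; exists (l * k); first exact: groupM.
  by move=> y Py; rewrite /= ul // permM gk // (Aut_mem sKA).
pose C u : {set X} := [set x | val x \in bfix W (P <*> R)%G (g \o u)].
have CE u : u \in ext_auts R -> #|C u| = #|bfix W (P <*> R)%G id|.
  move=> Au; rewrite -(stable_fix stW (Fgu u Au)) -(card_imset _ val_inj).
  congr #|pred_of_set _|; apply/setP=> w; apply/imsetP/idP => [[x Cx ->]|wJ].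
    by move: Cx; rewrite inE.
  have wX := autnorm_pts_fix (Fgu u Au) (guP u Au) (guK u Au) wJ.
  by exists (exist (fun w : W => w \in autnorm_pts W P K) w wX) => //; rewrite inE.
rewrite -sum_nat_const -(eq_bigr _ CE); apply: card_partition_sum.
- move=> x xR; have [|u Au xu] := autnorm_fix_ext NFf Fg gP _ gf xR; first by exists k.
  by exists u => //; rewrite /C in_set.
- move=> u Au; apply/subsetP=> x; rewrite /C in_set autnorm_bfixE // => xJ.
  apply/bfixP=> y Ry; have [_ _ _ uR] := ext_autsP _ _ Au.
  move/bfixP: xJ => /(_ y (subsetP sRJ y Ry)) /=.
  by rewrite uR // gf.
move=> u v x Au Av; rewrite [_ \in C u]in_set [_ \in C v]in_set => xu xv.
have [[Fu _ _ _] [Fv _ _ _]] := (ext_autsP _ _ Au, ext_autsP _ _ Av).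
have [[Ru FJu] [Rv FJv]] := (Aut_fusionP _ _ _ Fu, Aut_fusionP _ _ _ Fv).
apply: (eq_Aut Ru Rv) => y Jy.
apply: (fmor_inj Fg); rewrite ?(fmor_in FJu) ?(fmor_in FJv) //.
(* u and v coincide because the stabilizer of x is the graph of a single function. *)
have [Q [h [_ Ew]]] := genW (val x).
move: xu xv; rewrite !fix_bstab ?graph_sub ?(fmor_subl (Fgu u Au))
  ?(fmor_imgT (Fgu u Au)) ?(fmor_imgT (Fgu v Av)) //.
by rewrite Ew => /graph_subP[_ /(_ y Jy) /= ->] /graph_subP[_ /(_ y Jy) /= ->].
Qed.

(** Conjugation by the extension g of f to PR is injective and preserves the defining conditions,
    since g restricts on P to an element of K and maps R onto R'. *)
Lemma card_ext_auts_leq R R' f : fiso NF R R' f -> #|ext_auts R| <= #|ext_auts R'|.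
Proof.
move=> NFf; have fR := fiso_img NFf.
have /autnorm_morP[sRN sR'N Ff [g [Fg gP [k Kk gk] gf]]] := fiso_mor NFf.
have [mg injg _] := fmor_injhom Fg.
have injm : 'injm (morphm mg) by apply/injmP.
pose c := Aut_isom injm (subxx (P <*> R)%G).
have [sPJ sRJ] := joing_sub (erefl (P <*> R)).
have gJ : g @: (P <*> R)%G = (P <*> R')%G.
  have <- : morphm mg @* (P <*> R) = g @: (P <*> R) by rewrite morphimEdom.
  rewrite morphimY // !morphimEsub //=.
  rewrite -[LHS]/((g @: P) <*> (g @: R)) gP; congr (_ <*> _).
  by rewrite -fR; apply: eq_in_imset.
have Fg' := fiso_intro Fg gJ; have [g' [Fg'J gK g'K]] := fiso_inv Fg'.
have cE a y : a \in ext_auts R -> y \in P <*> R -> c a (g y) = g (a y).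
  by move=> /ext_autsP[/Aut_fusionP[Aa _] _ _ _] Jy; apply: (Aut_isomE injm (subxx _) Aa Jy).
have c_inj : {in ext_auts R &, injective c}.
  move=> a b Aa Ab cab.
  have [[/Aut_fusionP[Ra Fa] _ _ _] [/Aut_fusionP[Rb Fb] _ _ _]] := (ext_autsP _ _ Aa, ext_autsP _ _ Ab).
  apply: (eq_Aut Ra Rb) => y Jy; apply: (fmor_inj Fg); rewrite ?(fmor_in Fa) ?(fmor_in Fb) //.
  by rewrite -!cE // cab.
rewrite -(card_in_imset c_inj); apply: subset_leq_card.
apply/subsetP=> _ /imsetP[a Aa ->]; have [/Aut_fusionP[Ra Fa] aP [l Kl al] aR] := ext_autsP _ _ Aa.
have cP : {in P, c a =1 k^-1 * l * k}.
  move=> y Py; have Py' : k^-1 y \in P by apply: (Aut_mem sKA); rewrite ?groupV.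
  rewrite -{1}(permKV k y) -gk // cE ?(subsetP sPJ) // al // gk.
    by rewrite !permM.
  exact: (Aut_mem sKA Kl Py').
have Kklk : k^-1 * l * k \in K by rewrite !groupM ?groupV.
apply/ext_autsP; split.
- apply/Aut_fusionP; split.
    have := Aut_Aut_isom injm (subxx (P <*> R)%G) a; rewrite morphimEdom.
    by rewrite -[morphm mg @: _]/(g @: (P <*> R)%G) gJ.
  have := fmor_comp (fmor_comp (fiso_mor Fg'J) Fa) (fiso_mor Fg').
  apply: fmor_ext => y Jy; rewrite /= -cE ?g'K //.
  exact: (fmor_in (fiso_mor Fg'J) Jy).
- rewrite -[RHS](Aut_fusion_img (subsetP sKA _ Kklk)); exact: eq_in_imset.
- by exists (k^-1 * l * k).
move=> y; rewrite -fR => /imsetP[z Rz ->].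
by rewrite -gf // cE ?(subsetP sRJ) // aR.
Qed.

Lemma autnorm_semichar : semichar_biset NF X.
Proof.
apply: (@semichar_intro _ _ _ _ (fun R => (#|ext_auts R| * #|bfix W (P <*> R)%G id|)%N)).
- exact: autnorm_generated.
- move=> Q R f NFf; have [g [NFg _ _]] := fiso_inv NFf.
  have -> : #|ext_auts Q| = #|ext_auts R|.
    by apply/eqP; rewrite eqn_leq (card_ext_auts_leq NFf) (card_ext_auts_leq NFg).
  congr (_ * _)%N.
  have /autnorm_mor_fact := fiso_mor NFf.
  have /autnorm_morP[sRN sR'N Ff [h [Fh hP _ hf]]] := fiso_mor NFf.
  move=> _; apply: (@stable_fix_fiso _ _ F _ _ _ h) => //; rewrite /fiso Fh /=.
  have [mh _ _] := fmor_injhom Fh; have [sPJ sRJ] := joing_sub (erefl (P <*> Q)).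
  have <- : morphm mh @* (P <*> Q) = h @: (P <*> Q) by rewrite morphimEdom.
  rewrite morphimY // !morphimEsub //=.
  rewrite -[X in X == _]/((h @: P) <*> (h @: Q)) hP.
  by rewrite -(fiso_img NFf) (eq_in_imset hf).
- exact: autnorm_card_fix.
Qed.

End NormalizerBiset.

(** * The normalizer biset of the minimal characteristic biset *)

Section NormalizerMinimal.

Variables (p : nat) (gT : finGroupType) (S : {group gT}) (F : fusion_system S) (W : biset S).
Variables (P : {group gT}) (K : {group {perm gT}}).
Hypotheses (sPS : P \subset S) (sKA : K \subset Aut P).
Hypotheses (pr_p : prime p) (pS : p.-group S) (satF : saturated p F).
Hypotheses (minW : minimal_char_biset p F W) (fullP : fully_autnormalized F P K).
Implicit Types (Q R A : {group gT}) (f g h : gT -> gT).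

Local Notation N := (autnorm_group S P K).
Local Notation NF := (autnorm_fusion F K sPS).
Local Notation X := (autnorm_biset W P K).

(** A point of X^R is fixed by (PR, u) for some u in [ext_auts]; if u is conjugation by z,
    translation by z^-1 brings it among the points of Omega fixed by the diagonal of PR. These form
    one orbit of Z(PR), which lies in C_N(R) since C_S(P) <= N. *)
Lemma autnorm_left_orbit R (x y : X) : R \subset N -> centric F (P <*> R)%G ->
  (forall u, u \in ext_auts F P K R ->
     exists2 z, z \in 'C_N(R) & {in P <*> R, forall a, u a = a ^ z}) ->
  x \in bfix X R id -> y \in bfix X R id ->
  exists2 z, z \in 'C_N(R) & y = bact X x (z, 1).
Proof.
move=> sRN cPR extR xR yR.
have [[genW _] _] := minW.1; have sNS := autnorm_subS S P K.
have sJS := join_autnorm_sub sPS sRN; have [sPJ sRJ] := joing_sub (erefl (P <*> R)).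
have sPNS := join_autnorm_sub sPS (subxx N).
have NFid : NF R N id := fmor_id NF sRN (subxx N).
have Fid : F (P <*> R)%G (P <*> N)%G id.
  by apply: fmor_id => //=; rewrite genS // setUS.
have N1 z : z \in N -> (z, 1) \in setX N N by move=> Nz; apply/setXP.
have S1 z : z \in N -> (z, 1) \in setX S S.
  by move=> Nz; apply/setXP; rewrite (subsetP sNS).
have idK : exists2 k, k \in K & {in P, id =1 k}.
  by exists 1; rewrite ?group1 // => a _; rewrite perm1.
have untwist v : v \in bfix X R id -> exists2 z, z \in 'C_N(R) &
    bact W (val v) (z, 1) \in bfix W (P <*> R)%G id.
  move=> vR; have [|u Au vJ] := autnorm_fix_ext sKA genW NFid Fid (imset_id P) idK _ vR.
    by [].
  have [z /setIP[Nz Cz] uz] := extR u Au; exists z^-1.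
    by rewrite inE !groupV Nz.
  have sJu : (id \o u) @: (P <*> R)%G \subset S.
    have [/Aut_fusionP[_ Fu] _ _ _] := ext_autsP _ _ _ _ _ Au.
    exact: fmor_imgT (fmor_resS Fu (subxx _)).
  have Sz : z^-1 \in S by rewrite groupV (subsetP sNS).
  have := bfix_left sJS sJu Sz vJ; rewrite (@eq_graph _ _ _ id) // => a Ja /=.
  by rewrite uz // conjgK.
have [[z1 Cz1 x1] [z2 Cz2 y2]] := (untwist x xR, untwist y yR).
have [[Nz1 _] [Nz2 _]] := (setIP Cz1, setIP Cz2).
have sZC : 'Z(P <*> R) \subset 'C_N(R).
  rewrite subsetI [X in _ && X](subset_trans (subsetIr _ _)) ?centS // andbT.
  apply: subset_trans (@cent_sub_autnorm _ S P K (group1 K)).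
  by rewrite -(centric_cent cPR sJS) setIS // centS.
have [|||||w /(subsetP sZC) Cw Ew] :=
  @left_orbit_transitive _ _ W (P <*> R) id 'Z(P <*> R) _ _ _ _ _ _ _ x1 y2.
- exact: sJS.
- by rewrite imset_id.
- exact: subset_trans (center_sub _) sJS.
- by move=> w /setIP[_ cw] a Ja; apply/commute_sym/(centP cw).
- by rewrite (minimal_char_center pr_p pS satF minW sJS cPR).
have [Nw _] := setIP Cw.
exists (z1 * w * z2^-1); first by rewrite !groupM ?groupV.
apply: val_inj; rewrite autnorm_bactE; last by rewrite N1 // !groupM ?groupV.
have -> : (z1 * w * z2^-1, 1) = (z1, 1) * (w, 1) * (z2, 1)^-1 :> gT * gT.
  by congr (_, _); rewrite /= ?invg1 ?mulg1.
by rewrite !actMin ?groupM ?groupV ?S1 // -Ew actKin ?S1.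
Qed.

(** Conjugation by n agrees on P with conjugation by some h in P; hence N is contained in C_S(P)
    P. *)
Lemma autnorm_Inn_factor n : K \subset Inn P -> n \in N ->
  exists2 h, h \in P & n * h^-1 \in 'C_S(P).
Proof.
move=> sKI /autnormP[Sn nPn Kn].
have /morphimP[h nPh Ph Eh] := subsetP sKI _ Kn; exists h => //.
apply/setIP; split; first by apply: groupM; rewrite ?groupV // (subsetP sPS).
rewrite -(ker_conj_aut P).
apply/kerP; first by rewrite groupM ?groupV.
by rewrite morphM ?groupV // morphV // [X in X * _]Eh mulgV.
Qed.

(** If P <= R, then PR = R and u is trivial. In the second case u is conjugation on P by some g in
    P; writing n in N as c h with c in C_S(P) <= N and h in P, one gets n = u(n) = c h^g = n^g, so g
    centralizes N. *)
Lemma ext_auts_conj R : R \subset N ->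
  P \subset R \/ R = N /\ K \subset Inn P ->
  forall u, u \in ext_auts F P K R ->
    exists2 z, z \in 'C_N(R) & {in P <*> R, forall a, u a = a ^ z}.
Proof.
move=> sRN; case=> [sPR|[-> sKI]] u /ext_autsP[Fu uP [k Kk uk] uR].
  exists 1; first exact: group1.
  by move=> a; rewrite (joing_idPr sPR) => Ra; rewrite conjg1 uR.
have [_ FJu] := Aut_fusionP _ _ _ Fu.
have [sPJ sNJ] := joing_sub (erefl (P <*> N)).
have /morphimP[g nPg Pg Ek] := subsetP sKI _ Kk.
have ug a : a \in P -> u a = a ^ g by move=> Pa; rewrite uk // Ek norm_conj_autE.
have Ng : g \in N by apply/autnormP; rewrite (subsetP sPS) // -Ek.
have Cg : g \in 'C(N).
  apply/centP=> n Nn; have [h Ph Cnh] := autnorm_Inn_factor sKI Nn.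
  have Nnh : n * h^-1 \in N by apply: (subsetP (@cent_sub_autnorm _ S P K (group1 K))).
  case/setIP: Cnh => _ Cnh.
  have Jnh := subsetP sNJ _ Nnh; have Jh := subsetP sPJ h Ph.
  apply/commute_sym/commgP/conjg_fixP.
  have nhg : (n * h^-1) ^ g = n * h^-1.
    by apply/conjg_fixP/commgP; apply: (centP Cnh).
  by rewrite -[RHS]uR // -(mulgKV h n) conjMg nhg (fmorM FJu) // uR // ug.
exists g; first by rewrite inE Ng.
move=> c; rewrite (join_autnormE (subxx N)) => /mulsgP[a b Pa Nb ->].
rewrite (fmorM FJu (subsetP sPJ a Pa) (subsetP sNJ b Nb)) conjMg ug // uR //.
by congr (_ * _); apply/esym/conjg_fixP/commgP/commute_sym; apply: (centP Cg).
Qed.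

Hypothesis HK : Inn P \subset K \/ K \subset Inn P.

Lemma Inn_sub_autnorm : Inn P \subset K -> P \subset N.
Proof.
move=> sIK; apply/subsetP=> g Pg; have nPg := subsetP (normG P) g Pg.
by apply/autnormP; split; rewrite ?(subsetP sPS) // (subsetP sIK) // mem_morphim.
Qed.

Lemma ext_auts_conjN u : u \in ext_auts F P K N ->
  exists2 z, z \in 'C_N(N) & {in P <*> N, forall a, u a = a ^ z}.
Proof.
apply: ext_auts_conj => //; case: HK => [sIK|sKI]; [left|by right].
exact: Inn_sub_autnorm.
Qed.

Lemma autnorm_center_fix : #|bfix X N id| = #|'Z(N)|.
Proof.
have [[genW stW] _] := minW.1; have sNS := autnorm_subS S P K.
have sJS := join_autnorm_sub sPS (subxx N).
have sJ : P <*> N \subset S by [].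
(* A point of Omega fixed by the diagonal of S belongs to X, so X^N is not empty. *)
have /card_gt0P[w wS] := char_fix_card pr_p pS minW.1.
have wJ : w \in bfix W (P <*> N)%G id.
  by apply/bfixP=> a Ja; apply: (bfixP _ _ _ wS); apply: (subsetP sJS).
have idK : exists2 k, k \in K & {in P, id =1 k}.
  by exists 1; rewrite ?group1 // => a _; rewrite perm1.
have wX := autnorm_pts_fix genW (fmor_id F sJ (subxx S)) (imset_id P) idK wJ.
pose x : X := exist (fun w : W => w \in autnorm_pts W P K) w wX.
have xN : x \in bfix X N id.
  rewrite autnorm_bfixE ?imset_id //.
  by apply/bfixP=> a Na; apply: (bfixP _ _ _ wS); apply: (subsetP sNS).
apply: (card_single_left_orbit (subxx N) _ (center_sub N) _ xN).
- by rewrite imset_id.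
- by move=> z /setIP[_ cz] a Na; apply/commute_sym/(centP cz).
move=> y yN; apply: (autnorm_left_orbit _ _ ext_auts_conjN xN yN) => //.
exact: join_autnorm_centric.
Qed.

Lemma autnorm_char : char_biset p NF X.
Proof.
have [[genW stW] _] := minW.1.
apply: char_criterion => //.
- exact: pgroupS (autnorm_subS S P K) pS.
- exact: autnorm_Sylow.
- exact: autnorm_semichar.
- exact: autnorm_center_fix.
Qed.

Lemma autnorm_contains_one L : minimal_char_biset p NF L -> contains_precisely_one NF L X.
Proof.
move=> minL; have [[genW stW] _] := minW.1.
have [genX stX] : semichar_biset NF X by apply: autnorm_semichar.
apply: (contains_one_criterion genX pr_p _ _ stX autnorm_center_fix minL).
- exact: pgroupS (autnorm_subS S P K) pS.
- exact: autnorm_Sylow.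
- exact: minL.2 autnorm_char.
Qed.

Lemma autnorm_centric_iso L : centric F P -> minimal_char_biset p NF L -> biset_iso X L.
Proof.
move=> cP minL; have [[genW stW] _] := minW.1.
have pN : p.-group N := pgroupS (autnorm_subS S P K) pS.
have [genX stX] : semichar_biset NF X by apply: autnorm_semichar.
have [e inje he] := minL.2 _ autnorm_char; have [[_ stL] _] := minL.1.
have /card_gt0P[y0 y0N] := char_fix_card pr_p pN minL.1.
apply/biset_iso_sym/(biset_iso_bij inje he) => x.
suff : x \in e @: setT by case/imsetP=> y _ ->; exists y.
apply: contraT => nex.
have [R [Q [f [Ex NFf ER sPQ _]]]] := autnorm_bstab sPS sKA genW x.
have sRN : R \subset N by rewrite ER subsetIr.
(* The complement of the copy of Lambda is semicharacteristic, so a point of it with stabilizer (R,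
   f) forces one that is fixed by the diagonal of R. *)
have [_ cE1 _] := semichar_setD (semichar_setT stX) (semichar_set_hom inje he stL) (subsetT _).
have gsub h : h @: R \subset N -> graph R h \subset setX N N by move=> shN; apply: graph_sub.
have xR : x \in bfix X R f.
  by rewrite fix_bstab ?gsub ?(fmor_imgT NFf) // Ex.
have /card_gt0P[z /setIP[zR nez]] : 0 < #|bfix X R id :&: ([set: X] :\: e @: setT)|.
  rewrite -(cE1 R f NFf); apply/card_gt0P; exists x.
  by rewrite inE xR inE nex inE.
have eyR : e y0 \in bfix X R id.
  rewrite (hom_bfix _ inje he) ?gsub ?imset_id //.
  by apply/bfixP=> a Ra; apply: (bfixP _ _ _ y0N); apply: (subsetP sRN).
(* If Inn(P) <= K, then P lies in both Q and N, so P <= R. If K <= Inn(P), centricity of P gives N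
   <= P <= Q, hence R = N. *)
have extR u : u \in ext_auts F P K R ->
    exists2 z, z \in 'C_N(R) & {in P <*> R, forall a, u a = a ^ z}.
  apply: ext_auts_conj => //; case: HK => [sIK|sKI].
    by left; rewrite ER subsetI sPQ Inn_sub_autnorm.
  right; split=> //; apply/val_inj; rewrite /= ER; apply/setIidPr.
  apply: subset_trans sPQ; apply/subsetP=> n Nn.
  have [h Ph] := autnorm_Inn_factor sKI Nn.
  move/(subsetP (cP P id (fiso_id F sPS))) => Pnh.
  by rewrite -(mulgKV h n) groupM.
have cPR : centric F (P <*> R)%G.
  exact: centric_sub cP (joing_subl P R) (join_autnorm_sub sPS sRN).
have [c /setIP[Nc _] Ez] := autnorm_left_orbit sRN cPR extR eyR zR.
move: nez; rewrite inE inE andbT => /negP[].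
rewrite Ez (acts_act (hom_acts he)) ?imset_f //.
by apply/setXP.
Qed.

End NormalizerMinimal.

Theorem theorem9p15 (p : nat) (gT : finGroupType) (S : {group gT})
    (F : fusion_system S) (Omega : biset S)
    (P : {group gT}) (K : {group {perm gT}}) (sPS : P \subset S) :
  prime p -> p.-group S -> saturated p F ->
  minimal_char_biset p F Omega ->
  K \subset Aut P -> Inn P \subset K \/ K \subset Inn P ->
  fully_autnormalized F P K ->
  [/\ char_biset p (autnorm_fusion F K sPS) (autnorm_biset Omega P K),
      (forall Lambda : biset (autnorm_group S P K),
         minimal_char_biset p (autnorm_fusion F K sPS) Lambda ->
         contains_precisely_one (autnorm_fusion F K sPS) Lambda
           (autnorm_biset Omega P K)) &
      (centric F P ->
       forall Lambda : biset (autnorm_group S P K),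
         minimal_char_biset p (autnorm_fusion F K sPS) Lambda ->
         biset_iso (autnorm_biset Omega P K) Lambda)].
Proof.
move=> pr_p pS satF minW sKA HK fullP; split.
- exact: autnorm_char.
- by move=> L minL; exact: (autnorm_contains_one sKA pr_p pS satF minW fullP HK minL).
- by move=> cP L minL; exact: (autnorm_centric_iso sKA pr_p pS satF minW fullP HK cP minL).
Qed.
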